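(* Let $\Gamma$ be a finite connected graph and let $BB_\Gamma$ be the associated Bestvina-Brady group. Then $\Sigma^1(BB_\Gamma)^c = S(BB_\Gamma)\setminus\Sigma^1(BB_\Gamma)$ is a rationally defined spherical polyhedron in $S(BB_\Gamma)$. In particular, for every $m\geq 2$ and the Bieri-Stallings group $G_m$, the set $\Sigma^1(G_m)^c = S(G_m)\setminus\Sigma^1(G_m)$ is a rationally defined spherical polyhedron.
   Context: For a finite simplicial graph $\Gamma$, the right-angled Artin group $A_\Gamma$ has as generators the vertices of $\Gamma$, with defining relations $xy=yx$ whenever $x,y$ are joined by an edge. The Bestvina-Brady group $BB_\Gamma$ is the kernel of the homomorphism $A_\Gamma\to\mathbb{Z}$ sending every vertex generator to $1$; it is finitely generated when $\Gamma$ is connected. The Bieri-Stallings group $G_m$ is the kernel of the homomorphism $L_1\times\cdots\times L_m\to\mathbb{R}$ sending every $x_i$ and $y_i$ to $1$, where $L_i$ is the free group with basis $\{x_i,y_i\}$. A character of a group $G$ is a non-zero group homomorphism $\chi: G \to \mathbb{R}$. For a finitely generated group $G$, the character sphere $S(G)$ is the set of classes $[\chi]$ of characters of $G$, where two characters are equivalent if one is a positive real multiple of the other. $\Sigma^1(G)$ is the set of $[\chi]\in S(G)$ such that, for a finite generating set $X$ of $G$, the full subgraph of the Cayley graph of $G$ with respect to $X$ (edges from $g$ to $gx$, $x \in X$) spanned by the vertices $g$ with $\chi(g)\geq 0$ is connected (this does not depend on $X$). Let $G$ be finitely generated and let $d$ be the torsion-free rank of $G/[G,G]$. Choosing elements $g_1,\dots,g_d\in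 G$ whose images form a basis of $G/[G,G]$ modulo torsion identifies $\mathrm{Hom}(G,\mathbb{R})$ with $\mathbb{R}^d$ via $\chi\mapsto(\chi(g_1),\dots,\chi(g_d))$, and $S(G)$ with the sphere of rays in $\mathbb{R}^d$. A rationally defined closed hemisphere of $S(G)$ is a set $\{[\chi]\in S(G)\mid \sum_i v_i\chi(g_i)\geq 0\}$ for some non-zero rational vector $v=(v_1,\dots,v_d)\in\mathbb{Q}^d$. A rationally defined spherical polyhedron in $S(G)$ is a finite union of finite intersections of rationally defined closed hemispheres of $S(G)$. *)

(* Defs.v *)
From HB Require Import structures.
From mathcomp Require Import all_boot all_order all_algebra generic_quotient.
From mathcomp Require Import all_classical all_reals.

Set Implicit Arguments.
Unset Strict Implicit.
Unset Printing Implicit Defensive.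

Import Order.TTheory GRing.Theory Num.Theory.

Local Open Scope classical_set_scope.
Local Open Scope quotient_scope.
Local Open Scope group_scope.

(* Groups given by generators and relations. A letter (x, true) stands for the
   generator x and (x, false) for its inverse. *)

Definition word (X : Type) := seq (X * bool).

Inductive word_eq (X : Type) (rels : word X -> word X -> Prop) :
    word X -> word X -> Prop :=
| word_eq_refl u : word_eq rels u u
| word_eq_sym u v : word_eq rels u v -> word_eq rels v u
| word_eq_trans v u w : word_eq rels u v -> word_eq rels v w -> word_eq rels u w
| word_eq_cat u u' v v' :
    word_eq rels u u' -> word_eq rels v v' -> word_eq rels (u ++ v) (u' ++ v')
| word_eq_cancel x b : word_eq rels [:: (x, b); (x, ~~ b)] [::]
| word_eq_rel l r : rels l r -> word_eq rels l r.

Section Presentation.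
Variables (X : choiceType) (rels : word X -> word X -> Prop).

Definition word_eqb (u v : word X) : bool := `[< word_eq rels u v >].

Fact word_eqb_refl : reflexive word_eqb.
Proof. by move=> u; apply/asboolP; exact: word_eq_refl. Qed.

Fact word_eqb_sym : symmetric word_eqb.
Proof. by move=> u v; apply/asboolP/asboolP; exact: word_eq_sym. Qed.

Fact word_eqb_trans : transitive word_eqb.
Proof.
by move=> v u w /asboolP uv /asboolP vw; apply/asboolP; exact: word_eq_trans vw.
Qed.

Canonical word_equiv := EquivRel word_eqb word_eqb_refl word_eqb_sym word_eqb_trans.

Definition presented : Type := {eq_quot word_equiv}.

HB.instance Definition _ := Choice.on presented.

Definition wclass (u : word X) : presented := (\pi_({eq_quot word_equiv}) u)%qT.
Definition wrepr (a : presented) : word X := repr (a : {eq_quot word_equiv}).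

Lemma wreprK a : wclass (wrepr a) = a.
Proof. by rewrite /wclass /wrepr reprK. Qed.

Lemma wclassP u v : reflect (word_eq rels u v) (wclass u == wclass v).
Proof. by rewrite /wclass /presented eqmodE; exact: asboolP. Qed.

Lemma wclass_eq u v : word_eq rels u v -> wclass u = wclass v.
Proof. by move/wclassP/eqP. Qed.

Lemma wrepr_class u : word_eq rels (wrepr (wclass u)) u.
Proof. by apply/wclassP; rewrite wreprK. Qed.

Definition winv (u : word X) : word X := rev [seq (p.1, ~~ p.2) | p <- u].

Lemma winv_cons p u : winv (p :: u) = winv u ++ [:: (p.1, ~~ p.2)].
Proof. by rewrite /winv /= rev_cons cats1. Qed.

Lemma winv_cat u v : winv (u ++ v) = winv v ++ winv u.
Proof. by rewrite /winv map_cat rev_cat. Qed.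

Lemma winvK : involutive winv.
Proof.
by move=> u; rewrite /winv map_rev revK -map_comp map_id_in // => -[x b] _ /=;
  rewrite negbK.
Qed.

Lemma word_eq_catV u : word_eq rels (u ++ winv u) [::].
Proof.
elim: u => [|[x b] u IH]; first exact: word_eq_refl.
rewrite winv_cons catA -cat1s -!catA.
apply: word_eq_trans (word_eq_cancel rels x b).
apply: (@word_eq_cat _ _ [:: (x, b)] [:: (x, b)]); first exact: word_eq_refl.
rewrite catA -[X in word_eq _ _ X]cat0s.
by apply: word_eq_cat IH _; exact: word_eq_refl.
Qed.

Lemma word_eq_winv u v : word_eq rels u v -> word_eq rels (winv u) (winv v).
Proof.
move=> uv.
apply: (@word_eq_trans _ _ (winv u ++ (v ++ winv v))).
  rewrite -{1}[winv u]cats0; apply: word_eq_cat; first exact: word_eq_refl.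
  by apply: word_eq_sym; exact: word_eq_catV.
rewrite catA -[X in word_eq _ _ X]cat0s; apply: word_eq_cat; last exact: word_eq_refl.
apply: (@word_eq_trans _ _ (winv u ++ u)).
  by apply: word_eq_cat; [exact: word_eq_refl|exact: word_eq_sym].
by rewrite -{2}[u]winvK; exact: word_eq_catV.
Qed.

Definition pres_mul (a b : presented) := wclass (wrepr a ++ wrepr b).
Definition pres_inv (a : presented) := wclass (winv (wrepr a)).

Lemma pres_mulE u v : pres_mul (wclass u) (wclass v) = wclass (u ++ v).
Proof. by apply: wclass_eq; apply: word_eq_cat; exact: wrepr_class. Qed.

Lemma pres_invE u : pres_inv (wclass u) = wclass (winv u).
Proof. by apply: wclass_eq; apply: word_eq_winv; exact: wrepr_class. Qed.

Fact pres_mulA : associative pres_mul.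
Proof.
by move=> a b c; rewrite -[a]wreprK -[b]wreprK -[c]wreprK !pres_mulE catA.
Qed.

Fact pres_mul1 : left_id (wclass [::]) pres_mul.
Proof. by move=> a; rewrite -[a]wreprK pres_mulE. Qed.

Fact pres_mulr1 : right_id (wclass [::]) pres_mul.
Proof. by move=> a; rewrite -[a]wreprK pres_mulE cats0. Qed.

Fact pres_mulV : left_inverse (wclass [::]) pres_inv pres_mul.
Proof.
move=> a; rewrite -[a]wreprK pres_invE pres_mulE; apply: wclass_eq.
by rewrite -{2}[wrepr a]winvK; exact: word_eq_catV.
Qed.

Fact pres_mulrV : right_inverse (wclass [::]) pres_inv pres_mul.
Proof.
move=> a; rewrite -[a]wreprK pres_invE pres_mulE; apply: wclass_eq.
exact: word_eq_catV.
Qed.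

HB.instance Definition _ := isGroup.Build presented
  pres_mulA pres_mul1 pres_mulr1 pres_mulV pres_mulrV.

Definition pgen (x : X) : presented := wclass [:: (x, true)].

Variables (H : groupType) (f : X -> H).

Definition weval (u : word X) : H := \prod_(p <- u) (if p.2 then f p.1 else (f p.1)^-1).

Hypothesis f_rels : forall l r, rels l r -> weval l = weval r.

Lemma weval_eq u v : word_eq rels u v -> weval u = weval v.
Proof.
elim=> {u v} [//|//|v u w _ -> _ ->//|u u' v v' _ uu' _ vv'|x b|l r /f_rels//].
  by rewrite /weval !big_cat /=; congr (_ * _).
by rewrite /weval !big_cons big_nil mulg1 /=; case: b; rewrite /= ?mulgV ?mulVg.
Qed.

(* The proof argument is unused in the body: it is there so that the morphism
   instance below can be inferred. *)
Definition pres_lift of (forall l r, rels l r -> weval l = weval r) :=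
  fun a : presented => weval (wrepr a).

Fact pres_liftM : {morph pres_lift f_rels : a b / a * b}.
Proof.
move=> a b; rewrite /pres_lift; have -> : a * b = wclass (wrepr a ++ wrepr b) by [].
by rewrite (weval_eq (wrepr_class _)) /weval big_cat.
Qed.

HB.instance Definition _ :=
  isMultiplicative.Build presented H (pres_lift f_rels) pres_liftM.

Lemma pres_lift_pgen x : pres_lift f_rels (pgen x) = f x.
Proof.
by rewrite /pres_lift /pgen (weval_eq (wrepr_class _)) /weval big_seq1.
Qed.

End Presentation.

Section Kernel.
Variables (G H : groupType) (f : {multiplicative G -> H}).

Definition ker_pred : pred G := fun x => f x == 1.

Fact ker_closed : group_closed ker_pred.
Proof.
have f1 : f 1 = 1 by apply: (mulgI (f 1)); rewrite -gmulfM !mulg1.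
split=> [|x y]; rewrite !unfold_in ?f1// => /eqP fx /eqP fy.
by rewrite /ker_pred -(mulg1 (f _)) -fy -gmulfM divgK fx fy.
Qed.

Record kernel : Type := Kernel { kernel_val : G; _ : ker_pred kernel_val }.

HB.instance Definition _ := [isSub for kernel_val].
HB.instance Definition _ := [Choice of kernel by <:].
HB.instance Definition _ := SubChoice_isSubGroup.Build G ker_pred kernel ker_closed.

End Kernel.

Inductive commutation (V : Type) (e : rel V) : word V -> word V -> Prop :=
  Commutation x y of e x y :
    commutation e [:: (x, true); (y, true)] [:: (y, true); (x, true)].

Definition raag (V : finType) (e : rel V) : groupType := presented (commutation e).

Fact raag_height_rels (V : finType) (e : rel V) (l r : word V) :
  commutation e l r ->
  weval (fun=> 1%R : GRing.to_multiplicative int) l =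
  weval (fun=> 1%R : GRing.to_multiplicative int) r.
Proof. by case=> x y _; rewrite /weval !big_cons. Qed.

Definition raag_height (V : finType) (e : rel V) :
    {multiplicative raag e -> GRing.to_multiplicative int} :=
  pres_lift (@raag_height_rels V e).

Lemma raag_height_gen (V : finType) (e : rel V) (x : V) :
  raag_height e (pgen (commutation e) x) = 1%R.
Proof. exact: (pres_lift_pgen (@raag_height_rels V e) x). Qed.

Definition bestvina_brady (V : finType) (e : rel V) : groupType :=
  kernel (raag_height e).

Definition no_relation (X : Type) (l r : word X) : Prop := False.

Definition free_group (X : choiceType) : groupType := presented (@no_relation X).

Section BieriStallings.
Variables (R : realType) (m : nat).

(* The free factors have basis bool: true stands for x_i and false for y_i. *)
Definition free2_height :
    {multiplicative free_group bool -> GRing.to_multiplicative R} :=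
  @pres_lift _ _ (GRing.to_multiplicative R) (fun=> 1%R) (fun _ _ => False_ind _).

Lemma free2_height_gen b : free2_height (pgen (@no_relation bool) b) = 1%R.
Proof.
exact: (@pres_lift_pgen _ _ (GRing.to_multiplicative R) (fun=> 1%R)
          (fun _ _ => False_ind _) b).
Qed.

Definition bs_height (u : {ffun 'I_m -> free_group bool}) : GRing.to_multiplicative R :=
  \prod_(i < m) free2_height (u i).

Fact bs_heightM : {morph bs_height : u v / u * v}.
Proof.
move=> u v; rewrite /bs_height -[RHS](@big_split R 0%R +%R).
by apply: eq_bigr => i _; rewrite ffunE gmulfM.
Qed.

HB.instance Definition _ := isMultiplicative.Build
  {ffun 'I_m -> free_group bool} (GRing.to_multiplicative R) bs_height bs_heightM.

Definition bieri_stallings : groupType := kernel bs_height.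

End BieriStallings.

Inductive generated (G : groupType) (A : set G) : set G :=
| generated_in x : A x -> generated A x
| generated1 : generated A 1
| generatedM x y : generated A x -> generated A y -> generated A (x * y)
| generatedV x : generated A x -> generated A x^-1.

Definition generates (G : groupType) (X : seq G) : Prop :=
  forall x, generated [set` X] x.

Definition derived_subgroup (G : groupType) : set G :=
  generated [set z | exists x y : G, z = [~ x, y]].

(* The preimage in G of the torsion subgroup of G/[G,G] *)
Definition torsion_mod_derived (G : groupType) : set G :=
  [set x | exists2 n, (0 < n)%N & derived_subgroup (x ^+ n)].

Definition expgz (G : groupType) (x : G) (n : int) : G :=
  match n with Posz k => x ^+ k | Negz k => x ^- k.+1 end.

(* Existence and uniqueness of the coordinates of the image of every x in the
   quotient of G/[G,G] by its torsion subgroup *)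
Definition basis_mod_torsion (G : groupType) (d : nat) (g : 'I_d -> G) : Prop :=
  forall x : G, exists! a : {ffun 'I_d -> int},
    torsion_mod_derived (x^-1 * \prod_(i < d) expgz (g i) (a i)).

Local Open Scope ring_scope.

Section Sigma1.
Variables (R : realType) (G : groupType).

Definition real_hom := {multiplicative G -> GRing.to_multiplicative R}.
Definition hom_val (chi : real_hom) (x : G) : R := chi x.

Definition is_character (chi : real_hom) : Prop := exists x, hom_val chi x <> 0.

Definition char_class (chi : real_hom) : set real_hom :=
  [set psi | exists2 c : R, 0 < c & forall x, hom_val psi x = c * hom_val chi x].

Definition char_sphere : set (set real_hom) :=
  [set char_class chi | chi in is_character].

Definition cayley_edge (X : seq G) : rel G :=
  fun g h => has (fun x => (h == g * x)%g || (g == h * x)%g) X.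

Definition cayley_ge0_connected (X : seq G) (chi : real_hom) : Prop :=
  forall g h, 0 <= hom_val chi g -> 0 <= hom_val chi h ->
  exists p : seq G, [/\ path (cayley_edge X) g p, last g p = h
    & all (fun k => 0 <= hom_val chi k) p].

Definition Sigma1 : set (set real_hom) :=
  [set char_class chi | chi in [set chi | is_character chi /\
     exists2 X : seq G, generates X & cayley_ge0_connected X chi]].

Definition rational_hemisphere (d : nat) (g : 'I_d -> G) (v : 'rV[rat]_d) :
    set (set real_hom) :=
  [set char_class chi | chi in [set chi | is_character chi /\
     0 <= \sum_(i < d) ratr (v 0 i) * hom_val chi (g i)]].

(* The empty intersection is the whole sphere and the empty union is empty;
   this only matters for d = 0, when the sphere is empty. The notion does not
   depend on the chosen basis g. *)
Definition rational_polyhedron (P : set (set real_hom)) : Prop :=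
  exists (d : nat) (g : 'I_d -> G), basis_mod_torsion g /\
  exists F : seq (seq 'rV[rat]_d),
    (forall I v, I \in F -> v \in I -> v != 0) /\
    P = \big[setU/set0]_(I <- F)
          \big[setI/char_sphere]_(v <- I) rational_hemisphere g v.

End Sigma1.

Arguments char_sphere : clear implicits.
Arguments Sigma1 : clear implicits.

(* Main.v *)
Require Import Defs.
From mathcomp Require Import all_boot all_order all_algebra.
From mathcomp Require Import all_classical all_reals.
From mathcomp Require Import ring lra.

Set Implicit Arguments.
Unset Strict Implicit.
Unset Printing Implicit Defensive.

Import Order.TTheory GRing.Theory Num.Theory.

Local Open Scope classical_set_scope.
Local Open Scope ring_scope.

(** Let A be the Artin group of the graph and N the kernel of its height
    homomorphism to Z. Fix a vertex v0. When the graph is connected, the elements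
    x v0^-1, for x <> v0, form a basis of N/[N,N] (basis_elt_basis): along an
    edge xy one has x^k y^-k = (x y^-1)^k, so that a path from v0 to x gives
    x^k v0^-k = (x v0^-1)^k modulo [N,N], and N is generated by the elements
    v0^k x v0^-(k+1). Hence a character chi of N is the restriction of the
    homomorphism on A with values alpha x = chi (x v0^-1) on the vertices, with
    alpha v0 = 0.

    The criterion is that chi lies outside Sigma^1 exactly when alpha is
    constant on some nonempty set W of vertices whose removal disconnects the
    graph. For each W this is a system of equations alpha x = alpha y, that is, of
    pairs of opposite rational half-spaces; there are finitely many W, and the
    polyhedron results.

    If alpha is constant, with value s, on a separating W, then
    beta = alpha - s extends chi, kills W, and is nonzero at some vertex c1. Let
    C be the part of the complement of W that does not contain c1. The group A
    acts on two copies of the real line, every letter translating by its beta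
    value and the letters of C alone switching between the two copies, and only
    at a level r0. With c1 one descends from 0 to r0, switches there with a
    letter of C, and comes back: this is an element of N which a path in chi >= 0
    cannot reach from 1 if r0 is low enough, whatever the finite generating set
    (separating_disconnected). This is the usual argument that the Sigma^1 of a
    free product is empty, with the action in place of normal forms.

    If no such W exists, map A to the plane by g |-> (c, k), with c the
    alpha weight and k the height, and measure the squared distance F to the ray
    c >= 0, k = 0. To first order, a letter x changes F by twice its slope
    k + min(c,0) * alpha x. Once F is large, the vertices of small slope form a
    set on which alpha is constant; as this set and its subsets do not
    separate, the others are connected by edges, and each vertex of small slope
    is adjacent to one of them. Commuting squares then let a path be rerouted
    around any vertex where F is large, through places where F is smaller by 1
    (push, threshold_linked). A path in A joining two elements of N with
    chi >= 0 can thus be moved to a neighborhood of the ray, and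
    g |-> g v0^(-height g) carries it to a path in N, for a finite set of
    generators, along which chi is bounded below by a constant; translating
    by an element on which chi is large gives a path in chi >= 0
    (cayley_connected).

    The Bieri-Stallings group is covered by the same theorem: a product of m
    free groups of rank 2 is the Artin group of the graph on 'I_m * bool in which
    (i, b) and (j, c) are adjacent when i <> j, and the two height homomorphisms
    correspond. For that reason the argument is carried out for any group N with an
    injection into A whose image is the kernel of the height. *)

(** * Groups, homomorphisms and integer powers *)

Section GroupMorphisms.
Variables (G H : groupType) (f : G -> H).
Hypothesis fM : {morph f : x y / (x * y)%g}.

Lemma morph_one : f 1%g = 1%g.
Proof. by apply: (@mulgI _ (f 1%g)); rewrite -fM !mulg1. Qed.

Lemma morph_inv x : f x^-1%g = (f x)^-1%g.
Proof. by apply: (@mulgI _ (f x)); rewrite -fM !mulgV morph_one. Qed.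

Lemma morph_expn x n : f (x ^+ n)%g = (f x ^+ n)%g.
Proof. by elim: n => [|n IH]; rewrite ?expg0 ?morph_one// !expgS fM IH. Qed.

Lemma morph_expgz x n : f (expgz x n) = expgz (f x) n.
Proof. by case: n => n /=; rewrite ?morph_inv morph_expn. Qed.

End GroupMorphisms.

Section IntegerPowers.
Variable G : groupType.
Implicit Types (x y : G) (m n : int).

Lemma expgz0 x : expgz x 0 = 1%g. Proof. exact: expg0. Qed.
Lemma expgz1 x : expgz x 1 = x. Proof. exact: expg1. Qed.

Lemma expgzS x n : expgz x (n + 1) = (expgz x n * x)%g.
Proof.
case: n => [k|[|k]]; first by rewrite -PoszD addn1 /= expgSr.
  by rewrite /= mulVg.
have -> : Negz k.+1 + 1 = Negz k by rewrite !NegzE -addn1 PoszD opprD subrK.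
by rewrite /= [(x ^+ k.+2)%g]expgS invgM mulgVK.
Qed.

Lemma expgzP x n : expgz x (n - 1) = (expgz x n * x^-1)%g.
Proof. by rewrite -{2}[n](subrK 1) expgzS mulgK. Qed.

Lemma expgzMn x y n : commute x y -> expgz (x * y)%g n = (expgz x n * expgz y n)%g.
Proof.
move=> xy; case: n => n /=; first exact: expgMn.
rewrite expgMn// invgM; apply: commute_sym; apply: commuteV.
by apply: commute_sym; apply: commuteV; apply: commuteX2.
Qed.

Lemma expgzV x n : expgz x^-1%g n = (expgz x n)^-1%g.
Proof. by case: n => n /=; rewrite expVgn. Qed.

Lemma int_step_ind (P : int -> Prop) :
  P 0 -> (forall n, P n -> P (n + 1)) -> (forall n, P n -> P (n - 1)) ->
  forall n, P n.
Proof.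
move=> P0 PS PP n; elim: n => [//|n IH|n IH].
  by rewrite -addn1 PoszD; apply: PS.
by rewrite -addn1 PoszD opprD; apply: PP.
Qed.

Lemma expgzD x m n : expgz x (m + n) = (expgz x m * expgz x n)%g.
Proof.
elim/int_step_ind: n => [|n IH|n IH]; first by rewrite addr0 expgz0 mulg1.
  by rewrite addrA !expgzS IH mulgA.
by rewrite addrA !expgzP IH mulgA.
Qed.

Lemma expgzN x n : expgz x (- n) = (expgz x n)^-1%g.
Proof.
apply: (@mulgI _ (expgz x n)).
by rewrite -expgzD subrr expgz0 mulgV.
Qed.

End IntegerPowers.

Section AdditiveMaps.
Variables (G : groupType) (M : zmodType) (f : G -> M).
Hypothesis fM : {morph f : x y / (x * y)%g >-> x + y}.

Lemma additive1 : f 1%g = 0.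
Proof. by apply: (addrI (f 1%g)); rewrite -fM mulg1 addr0. Qed.

Lemma additiveV x : f x^-1%g = - f x.
Proof. by apply: (addrI (f x)); rewrite -fM mulgV additive1 subrr. Qed.

Lemma additiveX x n : f (x ^+ n)%g = f x *+ n.
Proof. by elim: n => [|n IH]; rewrite ?expg0 ?additive1// expgS fM IH mulrS. Qed.

Lemma additive_expgz x n : f (expgz x n) = f x *~ n.
Proof. by case: n => n /=; rewrite ?additiveV additiveX. Qed.

Lemma additive_prod (I : Type) (s : seq I) (F : I -> G) :
  f (\prod_(i <- s) F i)%g = \sum_(i <- s) f (F i).
Proof.
by elim: s => [|i s IH]; rewrite ?big_nil ?additive1// !big_cons fM IH.
Qed.

End AdditiveMaps.

Section RealHomomorphisms.
Variables (R : realType) (G : groupType) (chi : real_hom R G).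
Local Notation h := (hom_val chi).

Lemma hom_valM x y : h (x * y)%g = h x + h y.
Proof. by rewrite /hom_val gmulfM. Qed.

Lemma hom_val1 : h 1%g = 0.
Proof. exact: additive1 hom_valM. Qed.

Lemma hom_valV x : h x^-1%g = - h x.
Proof. exact: additiveV hom_valM x. Qed.

Lemma hom_valX x n : h (x ^+ n)%g = h x *+ n.
Proof. exact: additiveX hom_valM x n. Qed.

Lemma hom_val_expgz x n : h (expgz x n) = h x *~ n.
Proof. exact: additive_expgz hom_valM x n. Qed.

End RealHomomorphisms.

(** * Presented groups, Artin groups and weights *)

Section Presented.
Variables (X : choiceType) (rels : word X -> word X -> Prop).
Local Notation P := (presented rels : groupType).

Lemma presented_ind (Q : P -> Prop) :
  Q 1%g -> (forall g x, Q g -> Q (g * pgen rels x)%g) ->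
  (forall g x, Q g -> Q (g * (pgen rels x)^-1)%g) -> forall g, Q g.
Proof.
move=> Q1 QM QV g; rewrite -[g]wreprK.
elim/last_ind: (wrepr g) => [//|u [x b] IH]; rewrite -cats1 -pres_mulE.
case: b; first exact: QM.
have -> : wclass rels [:: (x, false)] = (pgen rels x)^-1%g.
  by rewrite -[RHS]/(pres_inv _) pres_invE.
exact: QV.
Qed.

Lemma presented_morph_eq (H : groupType) (f g : P -> H) :
  {morph f : x y / (x * y)%g} -> {morph g : x y / (x * y)%g} ->
  (forall x, f (pgen rels x) = g (pgen rels x)) -> f =1 g.
Proof.
move=> fM gM fg; elim/presented_ind => [|a x IH|a x IH].
- by rewrite (morph_one fM) (morph_one gM).
- by rewrite fM gM IH fg.
- by rewrite fM gM IH (morph_inv fM) (morph_inv gM) fg.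
Qed.

Lemma presented_commute (H : groupType) (f : P -> H) z :
  {morph f : x y / (x * y)%g} ->
  (forall x, commute z (f (pgen rels x))) -> forall a, commute z (f a).
Proof.
move=> fM fz; elim/presented_ind => [|a x IH|a x IH].
- by rewrite (morph_one fM); apply: commute1.
- by rewrite fM; apply: commuteM.
- by rewrite fM (morph_inv fM); apply: commuteM IH (commuteV _).
Qed.

End Presented.

Section Raag.
Variables (V : finType) (e : rel V).
Notation A := (raag e).
Notation cls := (wclass (commutation e)).

Definition letter (l : V * bool) : A := cls [:: l].

Lemma cls_cat u v : cls (u ++ v) = (cls u * cls v : A)%g.
Proof. by rewrite -[RHS]/(pres_mul _ _) pres_mulE. Qed.

Lemma letterV x b : letter (x, ~~ b) = (letter (x, b))^-1%g.
Proof. by rewrite -[RHS]/(pres_inv _) pres_invE. Qed.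

Lemma raag_ind (P : A -> Prop) :
  P 1%g -> (forall g l, P g -> P (g * letter l)%g) -> forall g, P g.
Proof.
move=> P1 PM; apply: presented_ind => // g x Pg; first exact: (PM g (x, true)).
by rewrite -(letterV x true); apply: PM.
Qed.

Lemma pgen_commute x y :
  e x y -> commute (letter (x, true)) (letter (y, true)).
Proof.
move=> xy; rewrite /commute -!cls_cat /=; apply: wclass_eq; apply: word_eq_rel.
by constructor.
Qed.

Lemma letter_commute x y b c : e x y -> commute (letter (x, b)) (letter (y, c)).
Proof.
move=> /pgen_commute xy.
have xc d : commute (letter (x, true)) (letter (y, d)).
  by case: d => //; rewrite (letterV y true); apply: commuteV.
case: b => //; rewrite (letterV x true).
by apply: commute_sym; apply: commuteV; apply: commute_sym.
Qed.

Definition signed (M : zmodType) (alpha : V -> M) (l : V * bool) : M :=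
  if l.2 then alpha l.1 else - alpha l.1.

Lemma signedN (M : zmodType) (alpha : V -> M) x b :
  signed alpha (x, ~~ b) = - signed alpha (x, b).
Proof. by rewrite /signed; case: b => /=; rewrite ?opprK. Qed.

Definition weight (M : zmodType) (alpha : V -> M) (g : A) : M :=
  \sum_(l <- wrepr g) signed alpha l.

Section Weight.
Variables (M : zmodType) (alpha : V -> M).
Local Notation w := (weight alpha).

Lemma weight_cls u : w (cls u) = \sum_(l <- u) signed alpha l.
Proof.
have inv u1 u2 : word_eq (commutation e) u1 u2 ->
    \sum_(l <- u1) signed alpha l = \sum_(l <- u2) signed alpha l.
  elim=> {u1 u2} [//|//|v u1 u2 _ -> _ ->//|u1 u2 v1 v2 _ IHu _ IHv|x b|l r].
  - by rewrite !big_cat /= IHu IHv.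
  - by rewrite !big_cons big_nil signedN addr0 subrr.
  - by case=> x y _; rewrite !big_cons !big_nil /signed /= !addr0 addrC.
exact: inv (wrepr_class _ _).
Qed.

Lemma weight_letter l : w (letter l) = signed alpha l.
Proof. by rewrite weight_cls big_seq1. Qed.

Lemma weightM g h : w (g * h)%g = w g + w h.
Proof.
by rewrite -[g]wreprK -[h]wreprK -cls_cat !weight_cls big_cat.
Qed.

Lemma weight1 : w 1%g = 0.
Proof. exact: additive1 weightM. Qed.

Lemma weightV g : w g^-1%g = - w g.
Proof. exact: additiveV weightM g. Qed.

Lemma weight_expgz g n : w (expgz g n) = w g *~ n.
Proof. exact: additive_expgz weightM g n. Qed.

End Weight.

Definition height (g : A) : int := weight (fun=> 1) g.

Lemma raag_heightE g : raag_height e g = height g :> int.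
Proof.
apply: (presented_morph_eq (H := GRing.to_multiplicative int)) => [a b|a b|x].
- by rewrite gmulfM.
- exact: weightM.
by rewrite raag_height_gen /height (weight_letter _ (x, true)).
Qed.

End Raag.

(** * Paths inside a region *)

Section Linked.
Variables (T : eqType) (E : rel T).
Implicit Types (P : pred T) (x y z : T).

Definition linked P x y : Prop :=
  exists p, [/\ path E x p, last x p = y & all P (x :: p)].

Lemma linked_refl P x : P x -> linked P x x.
Proof. by move=> Px; exists [::]; rewrite /= Px. Qed.

Lemma linked_trans P y x z : linked P x y -> linked P y z -> linked P x z.
Proof.
move=> [p [xp <- /= /andP[Px Pp]]] [q [yq <- /= /andP[_ Pq]]].
by exists (p ++ q); rewrite cat_path last_cat xp yq /= Px all_cat Pp Pq.
Qed.

Lemma linked_step P x y : E x y -> P x -> P y -> linked P x y.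
Proof. by move=> xy Px Py; exists [:: y]; rewrite /= xy Px Py. Qed.

Lemma linked_sym P x y : symmetric E -> linked P x y -> linked P y x.
Proof.
move=> Esym [p [xp <- Pp]]; exists (rev (belast x p)); split.
- by rewrite rev_path; under eq_path => a b do rewrite Esym.
- by case: p {xp Pp} => //= a p; rewrite rev_cons last_rcons.
- by rewrite -rev_rcons -lastI all_rev.
Qed.

Lemma linked_mono P P' x y : subpred P P' -> linked P x y -> linked P' x y.
Proof. by move=> PP' [p [xp xy Pp]]; exists p; split=> //; apply: sub_all Pp. Qed.

End Linked.

Lemma linked_map (T T' : eqType) (E : rel T) (E' : rel T') (P : pred T) (P' : pred T')
    (f : T -> T') x y :
  (forall a, P a -> P' (f a)) ->
  (forall a b, P a -> P b -> E a b -> linked E' P' (f a) (f b)) ->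
  linked E P x y -> linked E' P' (f x) (f y).
Proof.
move=> fP fE [p [xp <- Pp]]; elim: p x xp Pp => [|a p IH] x /=.
  by move=> _ /andP[Px _]; apply: linked_refl; apply: fP.
move=> /andP[xa ap] /and3P[Px Pa Pp].
by apply: linked_trans (fE _ _ Px Pa xa) _; apply: IH; rewrite //= Pa.
Qed.

Lemma fin_bound (R : realType) (T : finType) (f : T -> R) :
  exists2 B, 0 <= B & forall x, `|f x| <= B.
Proof.
exists (\sum_x `|f x|) => [|x]; first exact: sumr_ge0.
by rewrite (bigD1 x)//= lerDl sumr_ge0.
Qed.

Lemma fin_gap (R : realType) (T : finType) (f : T -> R) :
  (forall x, 0 <= f x) -> exists2 d, 0 < d & forall x, f x != 0 -> d <= f x.
Proof.
move=> f0; suff [d d0 H] : exists2 d, 0 < d & forall x, x \in enum T -> f x != 0 -> d <= f x.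
  by exists d => // x; apply: H; rewrite mem_enum.
elim: (enum T) => [|x s [d d0 IH]]; first by exists 1.
have [fx|fx] := eqVneq (f x) 0.
  by exists d => // y; rewrite inE => /predU1P[->|/IH//]; rewrite fx eqxx.
exists (Num.min d (f x)) => [|y]; first by rewrite lt_min d0 lt0r fx f0.
by rewrite inE ge_min => /predU1P[->|/IH H /H ->//]; rewrite lexx orbT.
Qed.

(** * Separating sets of vertices *)

Section Separating.
Variables (V : finType) (e : rel V).

Definition separating (W : {set V}) : Prop :=
  exists C : {set V}, [/\ exists2 x, x \in C & x \notin W,
    exists2 y, y \notin C & y \notin W &
    forall x y, x \in C -> x \notin W -> y \notin C -> y \notin W -> ~~ e x y].

(** The form in which connectedness of the complement of W is used: a property
    that spreads along the edges outside W holds everywhere outside W. *)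
Lemma nonseparating_ind (W : {set V}) (Q : V -> Prop) x :
  ~ separating W -> x \notin W -> Q x ->
  (forall y z, y \notin W -> z \notin W -> e y z -> Q y -> Q z) ->
  forall y, y \notin W -> Q y.
Proof.
move=> nsep xW Qx Qe y yW; apply: contrapT => nQy; apply: nsep.
exists [set z | `[< Q z >]]%SET; split.
- by exists x => //; rewrite inE; apply/asboolP.
- by exists y => //; rewrite inE; apply/asboolP.
move=> a b; rewrite !inE => Qa aW /asboolP nQb bW.
by apply/negP => ab; apply: nQb; exact: Qe _ _ aW bW ab Qa.
Qed.

(** In a connected graph the empty set does not separate. This lets a hypothesis
    about all separating sets also give the connectedness of the graph. *)
Lemma connect_nonseparating (W : {set V}) :
  (forall x y, connect e x y) -> separating W -> exists x, x \in W.
Proof.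
move=> conn [C [[x xC xW] [y yC yW] CD]]; apply: contrapT => W0.
have nW z : z \notin W by apply/negP => zW; apply: W0; exists z.
case/connectP: (conn x y) => p; elim: p x xC {xW} => [|z p IH] x xC /=.
  by move=> _ yx; rewrite yx xC in yC.
case/andP => xz zp; apply: IH (zp); case: (boolP (z \in C)) => // zC.
by move: (CD x z xC (nW _) zC (nW _)); rewrite xz.
Qed.

End Separating.

(** * Pushing paths of the Artin group towards a ray *)

Section Push.
Variables (R : realType) (V : finType) (e : rel V) (alpha : V -> R).
Notation A := (raag e).

Definition raag_edge : rel A := fun g h => [exists l, h == g * letter e l]%g.

Lemma raag_edge_sym : symmetric raag_edge.
Proof.
suff H g h : raag_edge g h -> raag_edge h g by move=> g h; apply/idP/idP; apply: H.
case/existsP => -[x b] /eqP ->; apply/existsP; exists (x, ~~ b).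
by rewrite letterV mulgK.
Qed.

Lemma raag_edge_letter g l : raag_edge g (g * letter e l)%g.
Proof. by apply/existsP; exists l. Qed.

Local Notation c := (weight alpha).
Definition rheight (g : A) : R := (height g)%:~R.
Local Notation k := rheight.
Definition depth (g : A) : R := Num.min (c g) 0.
Local Notation q := depth.

(** The squared distance from the point (weight, height) of g to the ray of points
    of nonnegative weight and height zero. It is convex with Lipschitz
    gradient, so that it is controlled from both sides by its first-order
    variation (energyM_le and energyM_ge). *)
Definition energy (g : A) : R := k g ^+ 2 + q g ^+ 2.
Local Notation F := energy.

(** Half the first-order variation of the energy when g is multiplied by x. *)
Definition slope (g : A) (x : V) : R := k g + q g * alpha x.

Lemma rheightM g h : k (g * h)%g = k g + k h.
Proof. by rewrite /k /height weightM intrD. Qed.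

Lemma energyM_le g h :
  F (g * h)%g <= F g + 2 * (k g * k h + q g * c h) + (k h ^+ 2 + c h ^+ 2).
Proof.
rewrite /F rheightM /q weightM.
have : Num.min (c g + c h) 0 ^+ 2 <= (Num.min (c g) 0 + c h) ^+ 2.
  by case: (leP (c g + c h) 0) => H1; case: (leP (c g) 0) => H2; nra.
by lra.
Qed.

Lemma energyM_ge g h : F g + 2 * (k g * k h + q g * c h) <= F (g * h)%g.
Proof.
rewrite /F rheightM /q weightM.
have : Num.min (c g) 0 ^+ 2 + 2 * (Num.min (c g) 0 * c h)
       <= Num.min (c g + c h) 0 ^+ 2.
  by case: (leP (c g + c h) 0) => H1; case: (leP (c g) 0) => H2; nra.
have := sqr_ge0 (k h); lra.
Qed.

Variable B : R.
Hypothesis alphaB : forall x, `|alpha x| <= B.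
Local Notation C := (4 * (1 + B ^+ 2)).

Lemma rheight_letter l : k (letter e l) = signed (fun=> 1) l.
Proof.
by rewrite /k /height weight_letter /signed; case: l.2; rewrite ?rmorphN rmorph1.
Qed.

Lemma slope_letter g l :
  k g * k (letter e l) + q g * c (letter e l) = signed (slope g) l.
Proof.
rewrite rheight_letter weight_letter /signed /slope; case: l.2; ring.
Qed.

Lemma letter_bound l : k (letter e l) ^+ 2 <= 1 /\ c (letter e l) ^+ 2 <= B ^+ 2.
Proof.
rewrite rheight_letter weight_letter /signed.
have := alphaB l.1; rewrite ler_norml => /andP[? ?].
by case: l.2; split; rewrite ?sqrrN; nra.
Qed.

Lemma energy_letter_le g l : F (g * letter e l)%g <= F g + 2 * signed (slope g) l + C.
Proof.
have := energyM_le g (letter e l); rewrite slope_letter.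
have [] := letter_bound l; have := sqr_ge0 B; lra.
Qed.

Lemma energy_letter_ge g l : F g + 2 * signed (slope g) l <= F (g * letter e l)%g.
Proof. by have := energyM_ge g (letter e l); rewrite slope_letter. Qed.

Lemma energy_letter2_le g l l' :
  F (g * letter e l * letter e l')%g <=
  F g + 2 * (signed (slope g) l + signed (slope g) l') + C.
Proof.
have := energyM_le g (letter e l * letter e l')%g.
rewrite mulgA rheightM weightM -!slope_letter.
have [] := letter_bound l; have [] := letter_bound l'.
set a := k (letter e l); set b := k (letter e l').
set a' := c (letter e l); set b' := c (letter e l').
have := sqr_ge0 (a - b); have := sqr_ge0 (a' - b'); nra.
Qed.

Variable d : R.
Hypothesis d0 : 0 < d.
Hypothesis alpha_gap : forall x y, alpha x != alpha y -> d <= `|alpha x - alpha y|.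

(** Two vertices with different values have slopes that differ by at least
    d * |min(c,0)|, so both can be small only if min(c,0) and k are bounded. The
    threshold bounds the energy there. Twice the slope of a dead vertex is less
    than C + 1, and the factor 3 in Q makes twice the other slope at least
    2 * (C + 1). *)
Definition energy_threshold : R :=
  let Q := 3 * (C + 1) / (2 * d) in Q ^+ 2 + ((C + 1) / 2 + Q * B) ^+ 2.
Local Notation R0 := energy_threshold.

(** The constant C bounds the second-order term for a product of at most two
    letters. A live letter, or its inverse, lowers the energy by at least 1. *)
Definition live g x := C + 1 <= 2 * `|slope g x|.

Lemma dead_gap g x y : R0 < F g -> ~~ live g x -> alpha x != alpha y ->
  2 * (C + 1) <= 2 * `|slope g y|.
Proof.
rewrite /live -ltNge => Fg dx /alpha_gap xy.
have B0 : 0 <= B by apply: le_trans (alphaB x).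
set Q := 3 * (C + 1) / (2 * d).
have QE : Q * (2 * d) = 3 * (C + 1).
  by rewrite /Q mulfVK// lt0r_neq0// mulr_gt0.
have Q0 : 0 <= Q by rewrite /Q divr_ge0 ?mulr_ge0 ?ltW//; have := sqr_ge0 B; lra.
(* otherwise |k| is bounded too, and the energy is at most R0 *)
have qQ : Q < `|q g|.
  rewrite ltNge; apply/negP => qQ; move: Fg; rewrite ltNge => /negP; apply.
  have kk : `|k g| <= (C + 1) / 2 + Q * B.
    have -> : k g = slope g x - q g * alpha x by rewrite /slope addrK.
    apply: le_trans (ler_normB _ _) _; rewrite normrM; apply: lerD; first lra.
    by apply: ler_pM.
  rewrite /F /R0 -/Q addrC; apply: lerD.
    by rewrite -[q g ^+ 2]real_normK ?num_real// ler_sqr ?nnegrE.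
  rewrite -[k g ^+ 2]real_normK ?num_real// ler_sqr ?nnegrE//.
  by apply: le_trans kk.
have slopeB : slope g y = slope g x - q g * (alpha x - alpha y) by rewrite /slope; ring.
have : `|q g * (alpha x - alpha y)| <= `|slope g y| + `|slope g x|.
  have -> : q g * (alpha x - alpha y) = slope g x - slope g y by rewrite slopeB; ring.
  by rewrite [leRHS]addrC ler_normB.
have := ler_pM Q0 (ltW d0) (ltW qQ) xy; rewrite normrM; lra.
Qed.

Definition downward g x : V * bool := (x, slope g x < 0).

Lemma signed_downward g x : signed (slope g) (downward g x) = - `|slope g x|.
Proof.
rewrite /signed /downward /=; case: ltrP => s0; last by rewrite ger0_norm.
by rewrite ltr0_norm// opprK.
Qed.

Lemma signed_le g l : signed (slope g) l <= `|slope g l.1|.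
Proof. by rewrite /signed; case: l.2; rewrite ?ler_norm// -normrN ler_norm. Qed.

Hypothesis alpha_nonconst : exists x y, alpha x != alpha y.
Hypothesis alpha_separating : forall W : {set V}, separating e W ->
  exists x y, [/\ x \in W, y \in W & alpha x != alpha y].

Section Level.
Variable M : R.
Hypothesis R0M : R0 <= M.
Local Notation low := (fun g => F g <= M).
Local Notation E := raag_edge.

Section Vertex.
Variable g : A.
Hypotheses (gM : M < F g) (gM1 : F g <= M + 1).

Let gR0 : R0 < F g. Proof. exact: le_lt_trans gM. Qed.
Let dead : {set V} := [set x | ~~ live g x]%SET.

Lemma dead_const x y : x \in dead -> y \in dead -> alpha x = alpha y.
Proof.
rewrite !inE => dx dy; apply/eqP; apply: contraT => xy.
have := dead_gap gR0 dx xy; move: dy; rewrite /live -ltNge.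
have := sqr_ge0 B; lra.
Qed.

(** On the dead vertices alpha takes a single value, and by hypothesis no
    set with that property separates. *)
Lemma dead_nonseparating (W : {set V}) : W \subset dead -> ~ separating e W.
Proof.
move=> /fintype.subsetP Wd /alpha_separating[x [y [/Wd xd /Wd yd]]].
by rewrite (dead_const xd yd) eqxx.
Qed.

Lemma live_ex : exists x, live g x.
Proof.
apply: contrapT => nl.
have dd x : x \in dead by rewrite inE; apply/negP => lx; apply: nl; exists x.
by case: alpha_nonconst => x [y]; rewrite (dead_const (dd x) (dd y)) eqxx.
Qed.

Lemma dead_live_gap x y : ~~ live g x -> live g y ->
  2 * `|slope g x| + C + 1 <= 2 * `|slope g y|.
Proof.
move=> dx ly; have xy : alpha x != alpha y.
  by apply: contraNneq dx => xy; rewrite /live /slope xy.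
have := dead_gap gR0 dx xy; move: dx; rewrite /live -ltNge; lra.
Qed.

(** Otherwise the dead vertices other than x would separate x from the live
    vertices. *)
Lemma dead_live_neighbor x : ~~ live g x -> exists2 y, live g y & e x y.
Proof.
move=> dx; apply: contrapT => ny.
apply: (@dead_nonseparating (dead :\ x)); first exact: subD1set.
have [z lz] := live_ex.
exists [set x]%SET; split.
- by exists x; rewrite !inE eqxx.
- by exists z; rewrite !inE ?lz ?andbF//; apply: contraNneq dx => <-.
move=> a b; rewrite !inE => /eqP -> _ bx; rewrite bx /= negbK => lb.
by apply/negP => ab; apply: ny; exists b.
Qed.

Lemma downward_low x : live g x -> low (g * letter e (downward g x))%g.
Proof.
rewrite /live => lx; have := energy_letter_le g (downward g x).
rewrite signed_downward; move: gM1; lra.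
Qed.

(** The opposite letter has positive first-order variation, and convexity then forces
    the energy to increase. *)
Lemma low_live l : low (g * letter e l)%g -> live g l.1 -> l = downward g l.1.
Proof.
case: l => x b /= lowl lx; apply/eqP; rewrite /downward xpair_eqE eqxx /=.
apply: contraT => nb; have {nb} bE : b = ~~ (slope g x < 0).
  by case: b (slope g x < 0) nb {lowl} => [] [].
move: lowl; rewrite leNgt bE => /negP[].
apply: lt_le_trans (energy_letter_ge g _).
rewrite signedN signed_downward; move: lx; rewrite /live.
have := sqr_ge0 B; move: gM; lra.
Qed.

Lemma square_linked l l' : commute (letter e l) (letter e l') ->
  low (g * letter e l)%g -> low (g * letter e l')%g ->
  low (g * letter e l * letter e l')%g ->
  linked E low (g * letter e l)%g (g * letter e l')%g.
Proof.
move=> ll' lowl lowl' lowll'; apply: (linked_trans (y := (g * letter e l * letter e l')%g)).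
  by apply: linked_step => //; apply: raag_edge_letter.
apply: linked_step => //; rewrite -mulgA ll' mulgA raag_edge_sym.
exact: raag_edge_letter.
Qed.

(** The live vertices are connected by edges, and along an edge the two
    downward letters commute: the square that they span at g has its three other
    corners below the level M. *)
Lemma downward_linked x y : live g x -> live g y ->
  linked E low (g * letter e (downward g x))%g (g * letter e (downward g y))%g.
Proof.
move=> lx ly.
pose Q z := linked E low (g * letter e (downward g x))%g (g * letter e (downward g z))%g.
apply: (@nonseparating_ind _ e dead Q x) => [||||]; rewrite ?inE ?lx ?ly//.
- exact: dead_nonseparating.
- by apply: linked_refl; exact: downward_low.
move=> a b; rewrite !inE !negbK => la lb ab Qa; apply: linked_trans Qa _.
apply: square_linked; [exact: letter_commute|exact: downward_low|exact: downward_low|].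
apply: le_trans (energy_letter2_le _ _ _) _; rewrite !signed_downward.
move: la lb; rewrite /live; have := sqr_ge0 B; move: gM1; lra.
Qed.

Lemma dead_step_low x b y : ~~ live g x -> live g y ->
  low (g * letter e (x, b) * letter e (downward g y))%g.
Proof.
move=> dx ly; apply: le_trans (energy_letter2_le _ _ _) _.
rewrite signed_downward; have := signed_le g (x, b).
have /= := dead_live_gap dx ly; move: gM1; lra.
Qed.

Lemma low_neighbors_linked l l' : low (g * letter e l)%g -> low (g * letter e l')%g ->
  linked E low (g * letter e l)%g (g * letter e l')%g.
Proof.
have H l0 : low (g * letter e l0)%g -> exists2 y, live g y &
    linked E low (g * letter e l0)%g (g * letter e (downward g y))%g.
  move=> lowl; have [ll|dl] := boolP (live g l0.1).
    exists l0.1 => //; rewrite -(low_live lowl ll); exact: linked_refl.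
  have [y ly xy] := dead_live_neighbor dl; exists y => //.
  case: l0 lowl dl xy => x b /= lowl dl xy.
  apply: square_linked => //; first exact: letter_commute.
  - exact: downward_low.
  - exact: dead_step_low.
move=> /H[y ly ly1] /H[z lz lz1].
apply: linked_trans ly1 _; apply: linked_trans (downward_linked ly lz) _.
by apply: linked_sym lz1; apply: raag_edge_sym.
Qed.

(** If g and its neighbor are both just above the level M, the letter between them is
    dead. It commutes with the downward letter of an adjacent live vertex, so the
    edge can be replaced by its parallel translate below the level. *)
Lemma high_neighbor_low l : M < F (g * letter e l)%g -> F (g * letter e l)%g <= M + 1 ->
  exists l', [/\ low (g * letter e l')%g, low (g * letter e l * letter e l')%g &
                 commute (letter e l) (letter e l')].
Proof.
case: l => x b hM hM1; have [lx|dx] := boolP (live g x).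
  have [bE|/negPf bE] := eqVneq b (slope g x < 0).
    by move: hM; rewrite bE ltNge (downward_low lx).
  have {}bE : b = ~~ (slope g x < 0) by case: b (slope g x < 0) bE {hM hM1} => [] [].
  have := energy_letter_ge g (x, b); rewrite {1}bE signedN signed_downward.
  move: lx; rewrite /live; have := sqr_ge0 B; move: gM hM1; lra.
have [y ly xy] := dead_live_neighbor dx.
exists (downward g y); split; first exact: downward_low.
  exact: dead_step_low.
exact: letter_commute.
Qed.

End Vertex.

(** The places below the level M to which a vertex of a path may be moved. All
    choices are equivalent (target_linked) and compatible with the edges
    (target_step), so that a path can be moved one vertex at a time. *)
Definition target g g' : Prop := if F g <= M then g' = g
  else exists2 l, g' = (g * letter e l)%g & low g'.

Lemma target_linked g g' g'' : F g <= M + 1 ->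
  target g g' -> target g g'' -> linked E low g' g''.
Proof.
rewrite /target; case: (leP (F g) M) => [gM|gM] gM1.
  by move=> -> ->; exact: linked_refl.
by move=> [l -> ?] [l' -> ?]; apply: low_neighbors_linked.
Qed.

Lemma target_step g h : F g <= M + 1 -> F h <= M + 1 -> E g h ->
  exists g' h', [/\ target g g', target h h' & linked E low g' h'].
Proof.
have half a b : F a <= M -> M < F b -> E a b ->
    exists a' b', [/\ target a a', target b b' & linked E low a' b'].
  move=> aM bM; rewrite raag_edge_sym => /existsP[l /eqP ab].
  exists a, a; rewrite /target aM leNgt bM /=; split=> //.
    by exists l.
  exact: linked_refl.
move=> gM1 hM1 gh.
have [gM|gM] := leP (F g) M; have [hM|hM] := leP (F h) M.
- by exists g, h; rewrite /target gM hM; split=> //; apply: linked_step.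
- exact: half.
- have [|h' [g' [? ? ?]]] := half h g hM gM; first by rewrite raag_edge_sym.
  by exists g', h'; split=> //; apply: linked_sym => //; apply: raag_edge_sym.
case/existsP: (gh) => l /eqP hE; rewrite hE in hM hM1.
have [l' [low1 low2 cll']] := high_neighbor_low gM gM1 hM hM1.
exists (g * letter e l')%g, (h * letter e l')%g.
rewrite /target hE (lt_geF gM) (lt_geF hM); split; try by exists l'.
apply: linked_step => //; rewrite -mulgA cll' mulgA; exact: raag_edge_letter.
Qed.

Lemma push g h : low g -> low h ->
  linked E (fun g => F g <= M + 1) g h -> linked E low g h.
Proof.
suff H p a a' b' : path E a p -> all (fun g => F g <= M + 1) (a :: p) ->
    target a a' -> target (last a p) b' -> linked E low a' b'.
  move=> gM hM [p [gp ghE Pp]].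
  by apply: (H p g g h gp Pp); rewrite /target ?ghE ?gM ?hM.
elim: p a a' b' => [|b p IH] a a' b' /=.
  by move=> _ /andP[aM _]; apply: target_linked.
move=> /andP[ab bp] /and3P[aM bM Pp] ta tb.
have [a1 [b1 [ta1 tb1 ab1]]] := target_step aM bM ab.
apply: linked_trans (target_linked aM ta ta1) _; apply: linked_trans ab1 _.
by apply: IH bp _ tb1 tb; rewrite /= bM Pp.
Qed.

End Level.

(** Any path lies below some level R0 + n, and push lowers the level by 1 as
    long as it stays above R0. *)
Lemma threshold_linked g h : F g <= R0 -> F h <= R0 ->
  linked raag_edge (fun g => F g <= R0) g h.
Proof.
move=> gR hR.
have down n : linked raag_edge (fun g => F g <= R0 + n%:R) g h ->
    linked raag_edge (fun g => F g <= R0) g h.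
  elim: n => [|n IH]; first by rewrite addr0.
  rewrite -natr1 addrA => gh; apply: IH; apply: push => //.
  - by rewrite lerDl.
  - by apply: le_trans gR _; rewrite lerDl.
  - by apply: le_trans hR _; rewrite lerDl.
have up a : exists n, linked raag_edge (fun g => F g <= R0 + n%:R) 1%g a.
  have below b : exists n, F b <= R0 + n%:R.
    exists (Num.truncn `|F b - R0|).+1.
    have := ler_norm (F b - R0); have /ltW := truncnS_gt `|F b - R0|; lra.
  elim/raag_ind: a => [|a l [n IH]].
    by have [n H] := below 1%g; exists n; apply: linked_refl.
  have [m H] := below (a * letter e l)%g; exists (n + m)%N.
  rewrite natrD; apply: linked_trans (_ : linked _ _ _ a) _.
    by apply: linked_mono IH => b /le_trans; apply; rewrite addrA lerDl.
  apply: linked_step; first exact: raag_edge_letter.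
    case: IH => p [_ <- /allP Pp]; apply: le_trans (Pp _ (mem_last _ _)) _.
    by rewrite addrA lerDl.
  by apply: le_trans H _; rewrite lerD2l lerDr.
have [n Hn] := up g; have [m Hm] := up h; apply: (down (n + m)%N); rewrite natrD.
apply: (linked_trans (y := 1%g)).
  apply: linked_sym; first exact: raag_edge_sym.
  by apply: linked_mono Hn => b /le_trans; apply; rewrite addrA lerDl.
apply: linked_mono Hm => b /le_trans; apply; rewrite lerD2l lerDr; exact: ler0n.
Qed.

End Push.

(** * Congruence modulo the derived subgroup *)

Section Derived.
Variable G : groupType.
Local Notation D := (@derived_subgroup G).
Local Open Scope group_scope.
Implicit Types x y z : G.

Lemma derived_comm x y : D [~ x, y].
Proof. by apply: generated_in; exists x, y. Qed.

Lemma derived_conj x y : D x -> D (x ^ y).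
Proof.
by move=> Dx; rewrite -[x ^ y](mulVKg x) -commgEl; apply: generatedM (derived_comm _ _).
Qed.

(** Equality in the abelianization. *)
Definition ab_eq x y := D (x^-1 * y).

Lemma ab_refl x : ab_eq x x.
Proof. by rewrite /ab_eq mulVg; apply: generated1. Qed.

Lemma ab_eqW x y : x = y -> ab_eq x y.
Proof. by move=> ->; apply: ab_refl. Qed.

Lemma ab_sym x y : ab_eq x y -> ab_eq y x.
Proof. by move=> /generatedV; rewrite invgM invgK. Qed.

Lemma ab_trans y x z : ab_eq x y -> ab_eq y z -> ab_eq x z.
Proof. by rewrite /ab_eq => xy /(generatedM xy); rewrite -mulgA mulVKg. Qed.

Lemma ab_mul x x' y y' : ab_eq x x' -> ab_eq y y' -> ab_eq (x * y) (x' * y').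
Proof.
rewrite /ab_eq => xx yy.
have -> : (x * y)^-1 * (x' * y') = (x^-1 * x') ^ y * (y^-1 * y').
  by rewrite /conjg invgM !mulgA mulgK.
by apply: generatedM => //; apply: derived_conj.
Qed.

Lemma ab_comm x y : ab_eq (x * y) (y * x).
Proof.
rewrite /ab_eq; have -> : (x * y)^-1 * (y * x) = [~ y, x].
  by rewrite invgM /commg /conjg !mulgA.
exact: derived_comm.
Qed.

Lemma ab_inv x y : ab_eq x y -> ab_eq x^-1 y^-1.
Proof.
move=> /ab_sym xy; rewrite /ab_eq.
have -> : x^-1^-1 * y^-1 = (y^-1 * x) ^ y^-1 by rewrite /conjg !invgK -!mulgA mulVKg.
exact: derived_conj.
Qed.

Lemma ab_expgzM x y n : ab_eq (expgz (x * y) n) (expgz x n * expgz y n).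
Proof.
have mulAC a b c d : ab_eq ((a * b) * (c * d)) ((a * c) * (b * d)).
  rewrite -!mulgA; apply: ab_mul; first exact: ab_refl.
  by rewrite !mulgA; apply: ab_mul; [apply: ab_comm|apply: ab_refl].
elim/int_step_ind: n => [|n IH|n IH]; first by rewrite !expgz0 mulg1; apply: ab_refl.
  rewrite !expgzS; apply: ab_trans (mulAC _ _ _ _).
  by apply: ab_mul => //; apply: ab_refl.
rewrite !expgzP; apply: ab_trans (mulAC _ _ _ _); apply: ab_mul => //.
by rewrite invgM; apply: ab_comm.
Qed.

Lemma ab_prodM (I : Type) (s : seq I) (E F : I -> G) :
  ab_eq (\prod_(i <- s) (E i * F i)) (\prod_(i <- s) E i * \prod_(i <- s) F i).
Proof.
elim: s => [|i s IH]; first by rewrite !big_nil mulg1; apply: ab_refl.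
rewrite !big_cons; apply: ab_trans (ab_mul (ab_refl _) IH) _.
rewrite -!mulgA; apply: ab_mul; first exact: ab_refl.
by rewrite !mulgA; apply: ab_mul; [apply: ab_comm|apply: ab_refl].
Qed.

End Derived.

Section AdditiveMapsDerived.
Variables (G : groupType) (M : zmodType) (f : G -> M).
Hypothesis fM : {morph f : x y / (x * y)%g >-> x + y}.

Lemma additive_derived x : derived_subgroup x -> f x = 0.
Proof.
elim=> {x} [x [y [z ->]]||x y _ fx _ fy|x _ fx].
- by rewrite /commg /conjg !fM !(additiveV fM) addrCA addKr addNr.
- exact: (additive1 fM).
- by rewrite fM fx fy addr0.
- by rewrite (additiveV fM) fx oppr0.
Qed.

Lemma additive_ab_eq x y : ab_eq x y -> f x = f y.
Proof. by move=> /additive_derived; rewrite fM (additiveV fM) => /eqP; rewrite addrC subr_eq0 => /eqP. Qed.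

End AdditiveMapsDerived.

(** * The kernel of the height homomorphism *)

Section HeightKernel.
Variables (V : finType) (e : rel V) (N : groupType) (emb : N -> raag e).
Notation A := (raag e).
Hypothesis embM : {morph emb : x y / (x * y)%g}.
Hypothesis emb_inj : injective emb.
Hypothesis emb_height : forall p, height (emb p) = 0.
Hypothesis emb_onto : forall g, height g = 0 -> exists p, emb p = g.
Variable v0 : V.
Local Notation a x := (letter e (x, true)).

Lemma height_letter l : height (letter e l) = signed (fun=> 1) l.
Proof. exact: weight_letter. Qed.

Lemma height_expgz x n : height (expgz (a x) n) = n.
Proof. by rewrite /height weight_expgz weight_letter /signed /= intz. Qed.

Lemma heightM (g h : A) : height (g * h)%g = height g + height h.
Proof. exact: weightM. Qed.

Lemma heightV (g : A) : height g^-1%g = - height g.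
Proof. exact: weightV. Qed.

Lemma level_ex (g : A) : exists p, emb p = (g * expgz (a v0) (- height g))%g.
Proof. by apply: emb_onto; rewrite heightM height_expgz addrN. Qed.

(** The element g v0^(-height g) of the kernel: the projection of A onto N along
    the powers of v0. *)
Definition level (g : A) : N := sval (cid (level_ex g)).

Lemma emb_level g : emb (level g) = (g * expgz (a v0) (- height g))%g.
Proof. exact: (svalP (cid (level_ex g))). Qed.

Lemma level_emb p : level (emb p) = p.
Proof. by apply: emb_inj; rewrite emb_level emb_height oppr0 expgz0 mulg1. Qed.

Lemma levelM g h : level (g * h)%g = (level g * level (expgz (a v0) (height g) * h))%g.
Proof.
apply: emb_inj; rewrite embM !emb_level !heightM height_expgz.
by rewrite (expgzN _ (height g)) -!mulgA mulKg.
Qed.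

Definition vertex_elt x : N := level (a x).

Lemma emb_vertex_elt x : emb (vertex_elt x) = (a x * (a v0)^-1)%g.
Proof. by rewrite emb_level height_letter expgzN expgz1. Qed.

Lemma vertex_elt0 : vertex_elt v0 = 1%g.
Proof. by apply: emb_inj; rewrite emb_vertex_elt mulgV (morph_one embM). Qed.

Hypothesis conn : forall x y, connect e x y.

(** Along an edge from z to y, the elements y and z commute, and y^n z^-n is the
    n-th power of y z^-1; the claim is carried along a path from v0 to x. *)
Lemma ab_eq_power x n : ab_eq (level (expgz (a x) n)) (expgz (vertex_elt x) n).
Proof.
case/connectP: (conn v0 x) => p; elim/last_ind: p x => [|p y IH] x.
  move=> _ ->; apply: ab_eqW; apply: emb_inj.
  rewrite emb_level height_expgz -expgzD subrr expgz0 vertex_elt0.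
  by elim/int_step_ind: n => [|n IH|n IH]; rewrite ?expgz0 ?expgzS ?expgzP ?invg1 ?mulg1 // (morph_one embM).
rewrite rcons_path last_rcons => /andP[vp pz] ->.
set z := last v0 p in pz; have {}IH := IH z vp erefl.
have [t tE] : exists t, emb t = (a y * (a z)^-1)%g.
  by apply: emb_onto; rewrite heightM heightV !height_letter subrr.
have cyz : commute (a y) (a z)^-1%g.
  by apply: commuteV; apply: commute_sym; apply: letter_commute.
have -> : level (expgz (a y) n) = (expgz t n * level (expgz (a z) n))%g.
  apply: emb_inj; rewrite embM (morph_expgz embM) !emb_level !height_expgz tE.
  by rewrite expgzMn// expgzV mulgA mulgVK.
have -> : vertex_elt y = (t * vertex_elt z)%g.
  by apply: emb_inj; rewrite embM !emb_vertex_elt tE mulgA mulgVK.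
apply: ab_sym; apply: ab_trans (ab_expgzM _ _ _) _.
by apply: ab_mul (ab_refl _) (ab_sym _).
Qed.

(** At height k, the generator v0^k x v0^-(k+1) is the quotient of x^(k+1) v0^-(k+1)
    by x^k v0^-k; by ab_eq_power, it does not depend on k modulo the derived
    subgroup. *)
Lemma ab_eq_level_letter g l :
  ab_eq (level (g * letter e l))
        (level g * expgz (vertex_elt l.1) (signed (fun=> 1%R) l))%g.
Proof.
have pos k x : ab_eq (level (expgz (a v0) k * a x)) (vertex_elt x).
  have -> : level (expgz (a v0) k * a x) =
      ((level (expgz (a x) k))^-1 * level (expgz (a x) (k + 1)))%g.
    apply: emb_inj; rewrite embM (morph_inv embM) !emb_level.
    rewrite heightM !height_expgz height_letter.
    by rewrite (expgzN _ k) invgM invgK expgzS -!mulgA mulKg.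
  apply: ab_trans (ab_mul (ab_inv (ab_eq_power _ _)) (ab_eq_power _ _)) _.
  by rewrite -expgzN -expgzD addKr expgz1; apply: ab_refl.
rewrite levelM; apply: ab_mul; first exact: ab_refl.
case: l => x []; first by rewrite /signed; apply: pos.
rewrite -[signed _ _]/(- 1%:Z) expgzN expgz1; apply: ab_trans (ab_inv (pos (height g - 1) x)).
apply: ab_eqW; apply: emb_inj; rewrite (morph_inv embM) !emb_level.
rewrite !heightM !height_expgz !height_letter /signed /=.
rewrite (letterV _ x true) subrK !expgzN !invgM invgK -!mulgA.
by congr (_ * (_ * _))%g; rewrite -expgzN.
Qed.

Definition vertex_count (x : V) (g : A) : int := weight (fun y => (y == x)%:Z) g.

Definition nonbase : {set V} := [set~ v0]%SET.
Definition basis_vertex (i : 'I_#|nonbase|) : V := enum_val i.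
Definition basis_elt (i : 'I_#|nonbase|) : N := vertex_elt (basis_vertex i).

Lemma basis_vertex_inj : injective basis_vertex.
Proof. exact: enum_val_inj. Qed.

Lemma basis_vertex_neq i : basis_vertex i != v0.
Proof. by have := enum_valP i; rewrite !inE. Qed.

Lemma basis_vertexP x : x != v0 -> exists i, x = basis_vertex i.
Proof.
move=> xv; have xA : x \in nonbase by rewrite !inE.
by exists (enum_rank_in xA x); rewrite /basis_vertex enum_rankK_in.
Qed.

Lemma prod_basis_vertex x n :
  (\prod_i expgz (basis_elt i) (n * (x == basis_vertex i)%:Z))%g = expgz (vertex_elt x) n.
Proof.
have [->|/basis_vertexP[j ->]] := eqVneq x v0.
  rewrite vertex_elt0 big1 => [|i _].
    by elim/int_step_ind: n => [|n IH|n IH]; rewrite ?expgz0 ?expgzS ?expgzP ?invg1 ?mulg1.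
  by rewrite eq_sym (negPf (basis_vertex_neq i)) mulr0 expgz0.
under eq_bigr => i _.
  have -> : expgz (basis_elt i) (n * (basis_vertex j == basis_vertex i)%:Z) =
      (if i == j then expgz (basis_elt j) n else 1)%g.
    rewrite (inj_eq basis_vertex_inj) eq_sym; case: eqVneq => [->|_].
      by rewrite mulr1.
    by rewrite mulr0 expgz0.
  over.
by rewrite -big_mkcond big_pred1_eq.
Qed.

Lemma ab_eq_basis g :
  ab_eq (level g) (\prod_i expgz (basis_elt i) (vertex_count (basis_vertex i) g)).
Proof.
elim/raag_ind: g => [|g l IH].
  rewrite big1 => [|i _]; last by rewrite /vertex_count weight1 expgz0.
  by apply: ab_eqW; rewrite -(morph_one embM) level_emb.
apply: ab_trans (ab_eq_level_letter _ _) _.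
apply: ab_trans (ab_mul IH (ab_refl _)) _.
rewrite -prod_basis_vertex; apply: ab_sym; apply: ab_trans (ab_prodM _ _ _).
apply: ab_eqW; apply: eq_bigr => i _; rewrite -expgzD; congr expgz.
rewrite /vertex_count weightM weight_letter; congr (_ + _).
by rewrite /signed; case: l.2; rewrite ?mulN1r ?mul1r.
Qed.

Lemma vertex_count_morph x :
  {morph (fun p => vertex_count x (emb p)) : p q / (p * q)%g >-> p + q}.
Proof. by move=> p q; rewrite embM; apply: weightM. Qed.

Lemma vertex_count_basis i j :
  vertex_count (basis_vertex i) (emb (basis_elt j)) = (j == i)%:Z.
Proof.
rewrite emb_vertex_elt /vertex_count weightM weightV !weight_letter /signed /=.
by rewrite (inj_eq basis_vertex_inj) eq_sym [v0 == _]eq_sym (negPf (basis_vertex_neq i)) subr0 eq_sym.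
Qed.

(** The existence of coordinates is ab_eq_basis. They are unique because the
    exponent sum of each vertex is a homomorphism to the torsion-free group Z. *)
Lemma basis_elt_basis : basis_mod_torsion basis_elt.
Proof.
move=> x; exists [ffun i => vertex_count (basis_vertex i) (emb x)]; split.
  exists 1%N => //; rewrite expg1.
  under eq_bigr do rewrite ffunE.
  by have := ab_eq_basis (emb x); rewrite level_emb.
move=> b [n n0 /(additive_derived (vertex_count_morph _)) Db].
apply/ffunP => i; rewrite ffunE; move: (Db (basis_vertex i)).
rewrite (additiveX (vertex_count_morph _)) vertex_count_morph.
rewrite (additiveV (vertex_count_morph _)) (additive_prod (vertex_count_morph _)).
under eq_bigr => j _ do rewrite (additive_expgz (vertex_count_morph _)) vertex_count_basis.
rewrite (bigD1 i)//= eqxx big1 => [|j /negPf ->]; last by rewrite mul0rz.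
rewrite addr0 intz -mulr_natr => /eqP; rewrite mulf_eq0 pnatr_eq0 -[n == 0]negbK -lt0n n0 orbF.
by rewrite addrC subr_eq0 => /eqP.
Qed.

Section Characters.
Variables (R : realType) (chi : real_hom R N).

Definition char_weight (x : V) : R := hom_val chi (vertex_elt x).

Lemma char_weight0 : char_weight v0 = 0.
Proof. by rewrite /char_weight vertex_elt0 hom_val1. Qed.

Lemma hom_val_weight p : hom_val chi p = weight char_weight (emb p).
Proof.
rewrite -{1}[p]level_emb; elim/raag_ind: (emb p) => [|g l IH].
  by rewrite weight1 -(morph_one embM) level_emb hom_val1.
rewrite (additive_ab_eq (hom_valM chi) (ab_eq_level_letter g l)) hom_valM.
rewrite hom_val_expgz IH weightM weight_letter; congr (_ + _).
by rewrite /signed; case: l.2.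
Qed.

End Characters.

End HeightKernel.

(** * Connected half-spaces of the Cayley graph *)

Section Cayley.
Variables (G : groupType) (X : seq G).
Local Open Scope group_scope.

Lemma cayley_edge_sym : symmetric (cayley_edge X).
Proof. by move=> g h; apply: eq_has => x; rewrite orbC. Qed.

Lemma cayley_edge_gen g x : x \in X -> cayley_edge X g (g * x).
Proof. by move=> xX; apply/hasP; exists x; rewrite ?eqxx. Qed.

Lemma linked_translate (P P' : pred G) t g h :
  (forall a, P a -> P' (t * a)) ->
  linked (cayley_edge X) P g h -> linked (cayley_edge X) P' (t * g) (t * h).
Proof.
move=> PP'; apply: linked_map => // a b Pa Pb ab.
apply: linked_step; [|exact: PP'|exact: PP'].
apply: etrans ab; apply: eq_has => x.
by rewrite -!mulgA !(inj_eq (@mulgI _ t)).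
Qed.

(** Connectedness of a half-space also gives generation, so no generating set of the
    kernel has to be known beforehand. *)
Lemma linked_generated P g : linked (cayley_edge X) P 1 g -> generated [set` X] g.
Proof.
move=> [p [gp <- _]]; have := generated1 [set` X].
elim: p 1 gp => [//|b p IH] a /= /andP[/hasP[x xX ab] bp] ga; apply: IH bp _.
have gx : generated [set` X] x by exact: generated_in.
case/orP: ab => /eqP abE; first by rewrite abE; apply: generatedM.
by rewrite -(mulgK x b) -abE; apply: generatedM => //; apply: generatedV.
Qed.

End Cayley.

Section HalfSpaces.
Variables (V : finType) (e : rel V) (N : groupType) (emb : N -> raag e).
Notation A := (raag e).
Hypothesis embM : {morph emb : x y / (x * y)%g}.
Hypothesis emb_inj : injective emb.
Hypothesis emb_height : forall p, height (emb p) = 0.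
Hypothesis emb_onto : forall g, height g = 0 -> exists p, emb p = g.
Variables (R : realType) (chi : real_hom R N) (alpha : V -> R).
Hypothesis chiE : forall p, hom_val chi p = weight alpha (emb p).
Hypothesis chi_char : is_character chi.
Local Notation h := (hom_val chi).

Section Connected.
Variable v0 : V.
Hypothesis alpha0 : alpha v0 = 0.
Hypothesis alpha_separating : forall W : {set V}, separating e W ->
  exists x y, [/\ x \in W, y \in W & alpha x != alpha y].
Local Notation a x := (letter e (x, true)).
Local Notation lev := (level emb_onto v0).

Lemma alpha_nonconst : exists x y, alpha x != alpha y.
Proof.
apply: contrapT => nc; case: chi_char => p; apply; rewrite chiE.
have ax x : alpha x = 0.
  by apply/eqP; apply: contraT => ax; case: nc; exists x, v0; rewrite alpha0.
by rewrite /weight big1// => l _; rewrite /signed !ax oppr0 if_same.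
Qed.

Lemma hom_val_level g : h (lev g) = weight alpha g.
Proof.
rewrite chiE emb_level weightM weight_expgz weight_letter /signed /= alpha0.
by rewrite mul0rz addr0.
Qed.

(** The steps by which level g moves when g moves by one letter, as long as
    the height of g stays in [-K, K]: finitely many, since the step depends on g
    through its height alone. *)
Definition slab_gens (K : nat) : seq N :=
  [seq lev (expgz (a v0) (j%:Z - K%:Z) * letter e l)%g
     | j <- iota 0 (2 * K + 1), l <- enum {: V * bool}].

Lemma slab_gens_mem (K : nat) (j : int) l : `|j| <= K%:Z -> lev (expgz (a v0) j * letter e l)%g \in slab_gens K.
Proof.
rewrite ler_norml => /andP[j1 j2]; have jK : 0 <= j + K%:Z by lra.
have -> : j = (absz (j + K%:Z))%:Z - K%:Z by rewrite gez0_abs// addrK.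
apply: allpairs_f; last by rewrite mem_enum.
by rewrite mem_iota /= add0n -ltz_nat gez0_abs// PoszD PoszM; lra.
Qed.

Lemma level_linked (X : seq N) (K : nat) (r : R) (g g' : A) :
  r <= K%:R ^+ 2 -> {subset slab_gens K <= X} ->
  linked (@raag_edge V e) (fun b => energy alpha b <= r) g g' ->
  linked (cayley_edge X) (fun p => - K%:R <= h p) (lev g) (lev g').
Proof.
move=> rK KX.
have inK b : energy alpha b <= r -> - K%:R <= h (lev b) /\ `|height b| <= K%:Z.
  move=> /le_trans/(_ rK) bK; have K0 : 0 <= K%:R :> R by exact: ler0n.
  have := sqr_ge0 (rheight R b); have := sqr_ge0 (depth alpha b).
  move: bK; rewrite /energy => bK k0 q0; split.
    have : - K%:R <= depth alpha b by rewrite leNgt; apply/negP => ?; nra.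
    by rewrite hom_val_level /depth => /le_trans; apply; rewrite ge_min lexx.
  have : `|rheight R b| <= K%:R.
    by rewrite -ler_sqr ?nnegrE// real_normK ?num_real//; lra.
  by rewrite /rheight -intr_norm -[K%:R]/(K%:Z%:~R) ler_int.
apply: linked_map => [b /inK[]//|b b' bR b'R].
case/existsP => l /eqP b'E; apply: linked_step; last first.
- by case: (inK _ b'R).
- by case: (inK _ bR).
rewrite b'E (levelM embM emb_inj); apply: cayley_edge_gen; apply: KX.
by apply: slab_gens_mem; case: (inK _ bR).
Qed.

(** The projection of a path near the ray only has chi >= -K. With an element
    t of the generating set such that chi t >= K, the path that goes from 1 to
    t, then along the translate by t of a path from 1 to t^-1 p t, and
    from p t back to p, stays in chi >= 0. *)
Lemma cayley_connected : exists2 X : seq N, generates X & cayley_ge0_connected X chi.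
Proof.
have [B B0 alphaB] := fin_bound alpha.
have [d d0 gap] := fin_gap (f := fun u : V * V => `|alpha u.1 - alpha u.2|) (fun=> normr_ge0 _).
have alpha_gap x y : alpha x != alpha y -> d <= `|alpha x - alpha y|.
  by move=> xy; apply: (gap (x, y)); rewrite normr_eq0 subr_eq0.
set r := energy_threshold B d.
have r0 : 0 <= r by rewrite addr_ge0// sqr_ge0.
pose K := (Num.truncn r).+1.
have rK : r <= K%:R ^+ 2.
  have rK1 := truncnS_gt r; have : 1 <= K%:R :> R by rewrite ler1n.
  rewrite -/K in rK1; nra.
have [t tK] : exists t, K%:R <= h t.
  case: chi_char => p /eqP p0.
  have [p' p'0] : exists p', 0 < h p'.
    have [?|?] := ltP 0 (h p); first by exists p.
    by exists p^-1%g; rewrite hom_valV oppr_gt0 lt_neqAle p0.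
  exists (p' ^+ (Num.truncn (K%:R / h p')).+1)%g; rewrite hom_valX -(mulr_natl (h p')).
  by rewrite -ler_pdivrMr// ltW// truncnS_gt.
pose X := t :: slab_gens K.
have to1 p : 0 <= h p -> linked (cayley_edge X) (fun p => - K%:R <= h p) 1%g p.
  move=> p0; have low q : 0 <= h q -> energy alpha (emb q) <= r.
    move=> q0; rewrite /energy /rheight /depth emb_height -chiE.
    by move/min_idPr: q0 => ->; rewrite expr0n /= addr0.
  rewrite -[1%g](level_emb emb_inj emb_height emb_onto v0) -[p](level_emb emb_inj emb_height emb_onto v0).
  apply: (level_linked rK) => [x|]; first by rewrite inE orbC => ->.
  apply: threshold_linked => //; [exact: alpha_nonconst| |]; apply: low => //.
  by rewrite hom_val1.
have h1 : 0 <= h 1%g by rewrite hom_val1.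
exists X.
  move=> p; have [p0|p0] := leP 0 (h p); first exact: linked_generated (to1 _ p0).
  rewrite -[p]invgK; apply: generatedV; apply: linked_generated (to1 _ _).
  by rewrite hom_valV oppr_ge0 ltW.
have t0 : 0 <= h t by apply: le_trans tK.
have from1 p : 0 <= h p -> linked (cayley_edge X) (fun p => 0 <= h p) 1%g p.
  move=> p0; apply: (linked_trans (y := t)).
    by apply: linked_step => //; rewrite -[t]mul1g; apply: cayley_edge_gen; rewrite inE eqxx.
  apply: (linked_trans (y := (p * t)%g)); last first.
    apply: linked_step => //; last by rewrite hom_valM addr_ge0.
    by rewrite cayley_edge_sym; apply: cayley_edge_gen; rewrite inE eqxx.
  rewrite -{1}[t]mulg1 -[(p * t)%g](mulVKg t).
  apply: linked_translate (to1 _ _) => [b|].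
    by rewrite hom_valM -lerBlDl sub0r; apply: le_trans; rewrite lerN2.
  by rewrite !hom_valM hom_valV; lra.
move=> p p' p0 p'0.
have [s [ps ss /= /andP[_ s0]]] : linked (cayley_edge X) (fun p => 0 <= h p) p p'.
  apply: linked_trans (from1 _ p'0); apply: linked_sym (from1 _ p0).
  exact: cayley_edge_sym.
by exists s.
Qed.

End Connected.

(** * Separating sets of constant weight *)

Hypothesis e_sym : symmetric e.

Section Sheets.
Variables (beta : V -> R) (twisted : pred V) (rigid : bool) (r0 : R).

(** Whether the letter x, read at level r, changes the sheet. If some twisted letter has
    nonzero weight, each twisted letter acts by the translation conjugated by the
    exchange of the two sheets at level r0; it switches on leaving r0 and on
    arriving there. Such a conjugate of a trivial translation is trivial, so if all
    twisted letters have weight 0 (the rigid case) they act by the exchange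
    at r0 itself. In both cases the twisted letters commute with one another. *)
Definition toggle (x : V) (r : R) : bool :=
  twisted x && ((r == r0) (+) (~~ rigid && (r + beta x == r0))).

(** An inverse letter switches according to the level at which it arrives, which makes
    it act as the inverse permutation. *)
Definition sheet_act (s : R * bool) (l : V * bool) : R * bool :=
  let r := if l.2 then s.1 else s.1 - beta l.1 in
  (s.1 + signed beta l, s.2 (+) toggle l.1 r).

Definition sheet_run (u : word V) (s : R * bool) := foldl sheet_act s u.

Hypothesis rigid0 : rigid -> forall x, twisted x -> beta x = 0.
Hypothesis twisted_edge : forall x y, e x y -> twisted x -> ~~ twisted y -> beta y = 0.

(** The defining relations hold for the action: an edge from a twisted vertex ends at
    a twisted vertex or at one of weight 0. *)
Lemma toggle_edge x y r : e x y ->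
  toggle x r (+) toggle y (r + beta x) = toggle y r (+) toggle x (r + beta y).
Proof.
move=> xy; have yx : e y x by rewrite e_sym.
rewrite /toggle; case tx : (twisted x); case ty : (twisted y) => //=.
- case rg : rigid => /=; first by rewrite !rigid0// !addr0.
  rewrite (addrAC r (beta y)); move: (r == r0) (r + beta x == r0) (r + beta y == r0).
  by move: (_ == r0) => [] [] [] [].
- by rewrite (twisted_edge xy tx) ?ty// addr0 addbF.
- by rewrite (twisted_edge yx ty) ?tx// addr0 addbF.
Qed.

Lemma sheet_run_cat u v s : sheet_run (u ++ v) s = sheet_run v (sheet_run u s).
Proof. exact: foldl_cat. Qed.

Lemma sheet_run_eq u v s : word_eq (commutation e) u v -> sheet_run u s = sheet_run v s.
Proof.
move=> uv; elim: uv s => {u v} [//|u v _ IH s|v u w _ IHu _ IHv s|u u' v v' _ IHu _ IHv s|x b [r i]|l r].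
- by rewrite IH.
- by rewrite IHu IHv.
- by rewrite !sheet_run_cat IHu IHv.
- rewrite /= /sheet_act /signed; case: b => /=.
    by rewrite addrK -addbA addbb addbF.
  by rewrite subrK -addbA addbb addbF.
case=> x y xy [r' i]; rewrite /= /sheet_act /signed /= -!addbA (toggle_edge _ xy).
by rewrite addrAC.
Qed.

Definition sheet_state (g : A) := sheet_run (wrepr g) (0, false).

Lemma sheet_stateM g u : sheet_state (g * wclass _ u)%g = sheet_run u (sheet_state g).
Proof.
rewrite /sheet_state -{1}[g]wreprK -cls_cat (sheet_run_eq _ (wrepr_class _ _)).
exact: sheet_run_cat.
Qed.

Lemma sheet_state1 : sheet_state 1%g = (0, false).
Proof. exact: (sheet_run_eq _ (wrepr_class _ [::])). Qed.

Lemma sheet_state_letter g l : sheet_state (g * letter e l)%g = sheet_act (sheet_state g) l.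
Proof. exact: sheet_stateM. Qed.

Lemma sheet_state_weight g : (sheet_state g).1 = weight beta g.
Proof.
elim/raag_ind: g => [|g l IH]; first by rewrite sheet_state1 weight1.
by rewrite sheet_state_letter weightM weight_letter -IH.
Qed.

Lemma sheet_run_nseq x b n r i : ~~ twisted x ->
  sheet_run (nseq n (x, b)) (r, i) = (r + signed beta (x, b) *+ n, i).
Proof.
move=> tx; elim: n r i => [|n IH] r i; first by rewrite addr0.
rewrite /= {1}/sheet_act /toggle (negPf tx) /= addbF -/(sheet_run _ _) IH.
by rewrite mulrS addrA.
Qed.

Lemma sheet_state_power g x n : ~~ twisted x ->
  (sheet_state (g * expgz (letter e (x, true)) n)%g).2 = (sheet_state g).2.
Proof.
move=> tx; have P l k : l.1 = x -> (sheet_state (k * letter e l)%g).2 = (sheet_state k).2.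
  by move=> lx; rewrite sheet_state_letter /sheet_act /toggle lx (negPf tx) addbF.
elim/int_step_ind: n => [|n IH|n IH]; first by rewrite expgz0 mulg1.
  by rewrite expgzS mulgA P.
by rewrite expgzP mulgA -(letterV e x true) P.
Qed.

End Sheets.

(** A word moves the level by a bounded amount, so it cannot reach r0 from
    far above. The bound has to be independent of r0, which is chosen after the
    generating set. *)
Lemma sheet_run_stable (beta : V -> R) twisted rigid u : exists2 D, 0 <= D &
  forall r0 r i, r0 + D < r -> (sheet_run beta twisted rigid r0 u (r, i)).2 = i.
Proof.
elim: u => [|[x b] u [D D0 IH]]; first by exists 0.
exists (`|beta x| + D) => [|r0 r i rD]; first by rewrite addr_ge0.
have [b1 b2] : - `|beta x| <= beta x /\ beta x <= `|beta x|.
  by apply/andP; rewrite -ler_norml.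
rewrite /= -/(sheet_run _ _ _ _ _ _) /sheet_act /= IH; last first.
  by rewrite /signed; case: b => /=; lra.
have nr0 s : r0 < s -> s == r0 = false by move=> /gt_eqF.
rewrite /toggle; case: b => /=; rewrite !nr0 ?subrK ?nr0 ?andbF ?addbF//; lra.
Qed.

Lemma sheet_run_stable_seq (beta : V -> R) twisted rigid (us : seq (word V)) : exists2 D, 0 <= D &
  forall u r0 r i, u \in us -> r0 + D < r -> (sheet_run beta twisted rigid r0 u (r, i)).2 = i.
Proof.
elim: us => [|u us [D D0 IH]]; first by exists 0.
have [D' D'0 IH'] := sheet_run_stable beta twisted rigid u.
exists (D + D') => [|v r0 r i]; first by rewrite addr_ge0.
by rewrite inE => /predU1P[->|vus] rD; [apply: IH'|apply: IH => //]; lra.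
Qed.

Section Disconnected.
Variables (w0 : V) (twisted : pred V) (c1 c2 : V).
Local Notation beta := (fun x => alpha x - alpha w0).

Lemma weight_shift (g : A) : weight beta g = weight alpha g - alpha w0 *~ height g.
Proof.
elim/raag_ind: g => [|g l IH].
  by rewrite /height !weight1 mulr0z subr0.
rewrite /height !weightM -/(height g) IH mulrzDr !weight_letter /signed.
by case: l.2 => /=; rewrite ?mulrN1z ?mulr1z; ring.
Qed.

Lemma hom_val_shift p : h p = weight beta (emb p).
Proof. by rewrite weight_shift emb_height mulr0z subr0 chiE. Qed.

Hypothesis tw0 : ~~ twisted w0.
Hypothesis tc1 : ~~ twisted c1.
Hypothesis beta_c1 : beta c1 != 0.
Hypothesis tc2 : twisted c2.
Hypothesis twisted_edge : forall x y, e x y -> twisted x -> ~~ twisted y -> beta y = 0.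

(** The generators do not change the sheet as long as chi >= 0, because r0 is far below
    the levels that they reach. The element p, of nonnegative character, is on the
    other sheet than 1: it is c1^n c^(+-1) c1^-n, brought to height 0 by a power of
    w0, which has weight 0 and does not switch. *)
Lemma cayley_disconnected (X : seq N) : ~ cayley_ge0_connected X chi.
Proof.
move=> XC.
have [rigid [c [tc rigid0 nrigid]]] : exists (rigid : bool) (c : V), [/\ twisted c,
    rigid -> forall x, twisted x -> beta x = 0 & ~~ rigid -> beta c != 0].
  have [[c tc bc]|nc] := pselect (exists2 c, twisted c & beta c != 0).
    by exists false, c.
  exists true, c2; split=> // _ x tx; apply/eqP; apply: contraT => bx.
  by case: nc; exists x.
have [D D0 stable] := sheet_run_stable_seq beta twisted rigid [seq wrepr (emb x) | x <- X].
pose n := (Num.truncn (D / `|beta c1|)).+1.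
(* after n letters c1 the level is below the reach of all generators *)
have nD : D < `|beta c1| *+ n.
  by rewrite -mulr_natl -ltr_pdivrMr ?normr_gt0// truncnS_gt.
pose r0 := - (`|beta c1| *+ n).
pose b1 := beta c1 < 0; pose b2 := rigid || (0 < beta c).
have s1 : signed beta (c1, ~~ b1) = `|beta c1|.
  by rewrite /signed /b1 /=; case: ltrP => b0 /=; [rewrite ltr0_norm|rewrite ger0_norm].
have s1N : signed beta (c1, b1) = - `|beta c1| by rewrite -s1 signedN opprK.
pose u := nseq n (c1, b1) ++ [:: (c, b2)] ++ nseq n (c1, ~~ b1).
pose state := sheet_state beta twisted rigid r0.
have run_u : sheet_run beta twisted rigid r0 u (0, false) = (`|beta c|, true).
  rewrite /u !sheet_run_cat [sheet_run _ _ _ _ (nseq n (c1, b1)) _]sheet_run_nseq// s1N add0r mulNrn -/r0.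
  have -> : sheet_run beta twisted rigid r0 [:: (c, b2)] (r0, false) = (r0 + `|beta c|, true).
    rewrite /= /sheet_act /toggle /signed /b2 tc /=; have [rg|nrg] := boolP rigid => /=.
      by rewrite (rigid0 rg c tc) normr0 eqxx.
    have := nrigid nrg; rewrite neq_lt => /orP[c0|c0].
      rewrite ltNge (ltW c0) /= subrK eqxx -subr_eq0 ltr0_norm//.
      by rewrite [_ - _ - _]addrAC subrr add0r oppr_eq0 lt_eqF.
    by rewrite c0 /= eqxx gtr0_norm// -subr_eq0 [_ + _ - _]addrAC subrr add0r gt_eqF.
  by rewrite sheet_run_nseq// s1 /r0 addrAC addNr add0r.
have stateu : state (wclass _ u) = (`|beta c|, true).
  by rewrite -[wclass _ u]mul1g /state sheet_stateM// sheet_state1.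
pose k := height (wclass (commutation e) u).
have [p pE] : exists p, emb p = (wclass _ u * expgz (letter e (w0, true)) (- k))%g.
  apply: emb_onto; rewrite /height weightM weight_expgz weight_letter /signed /=.
  by rewrite intz subrr.
have hp : h p = `|beta c|.
  rewrite hom_val_shift pE weightM weight_expgz weight_letter /signed /= subrr.
  by rewrite mul0rz addr0 -(sheet_state_weight (twisted := twisted) (rigid := rigid) r0)// -/state stateu.
have [||s [sp slast s0]] := XC 1%g p; first by rewrite hom_val1.
  by rewrite hp.
suff inv q s' : path (cayley_edge X) q s' -> all (fun q => 0 <= h q) (q :: s') ->
    (state (emb (last q s'))).2 = (state (emb q)).2.
  have := inv 1%g s sp; rewrite slast /= hom_val1 lexx s0 (morph_one embM).
  rewrite pE /state sheet_state_power// -/state stateu /state sheet_state1//.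
  by move=> /(_ isT).
have step a x : x \in X -> 0 <= h a -> (state (emb (a * x)%g)).2 = (state (emb a)).2.
  move=> xX a0; rewrite embM -[emb x]wreprK /state sheet_stateM//.
  case sa : (sheet_state _ _ _ _ (emb a)) => [r i]; apply: stable; first exact: map_f.
  have : r = h a by rewrite hom_val_shift -(sheet_state_weight (twisted := twisted) (rigid := rigid) r0)// sa.
  by move=> ->; rewrite /r0; lra.
elim: s' q => [//|b s' IH] q /= /andP[/hasP[x xX qb] bs] /and3P[q0 b0 s'0].
rewrite IH//= ?b0//; case/orP: qb => /eqP ->; first exact: step.
by rewrite step.
Qed.

End Disconnected.

(** As chi is nonzero, alpha differs from its value on W at some vertex v. The
    twisted vertices are those of the part, C or its complement outside W, that
    does not contain v. *)
Lemma separating_disconnected (W : {set V}) (X : seq N) :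
  separating e W -> (exists x, x \in W) ->
  (forall x y, x \in W -> y \in W -> alpha x = alpha y) ->
  ~ cayley_ge0_connected X chi.
Proof.
move=> [C [[x xC xW] [y yC yW] CD]] [w wW] aW.
have [v vW av] : exists2 v, v \notin W & alpha v - alpha w != 0.
  apply: contrapT => nv; case: chi_char => p; apply.
  rewrite (hom_val_shift w) /weight big1// => l _; rewrite /signed.
  suff -> : alpha l.1 - alpha w = 0 by rewrite oppr0 if_same.
  have [lW|lW] := boolP (l.1 \in W); first by rewrite (aW _ w lW wW) subrr.
  by apply/eqP; apply: contraT => lv; case: nv; exists l.1.
have [vC|vC] := boolP (v \in C).
  apply: (@cayley_disconnected w (fun z => (z \notin C) && (z \notin W)) v y).
  - by rewrite wW andbF.
  - by rewrite vC.
  - exact: av.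
  - by rewrite yC.
  move=> a b ab /andP[aC a'W]; rewrite negb_and !negbK.
  case: (boolP (b \in W)) => [bW _|bW]; first by rewrite (aW b w bW wW) subrr.
  by rewrite orbF => bC; move: (CD b a bC bW aC a'W); rewrite e_sym ab.
apply: (@cayley_disconnected w (fun z => (z \in C) && (z \notin W)) v x).
- by rewrite wW andbF.
- by rewrite (negPf vC).
- exact: av.
- by rewrite xC.
move=> a b ab /andP[aC a'W]; rewrite negb_and negbK.
case: (boolP (b \in W)) => [bW _|bW]; first by rewrite (aW b w bW wW) subrr.
by rewrite orbF => bC; move: (CD a b aC a'W bC bW); rewrite ab.
Qed.

End HalfSpaces.

(** * The complement as a rational polyhedron *)

Lemma mem_bigsetI (T : Type) (I : eqType) (s : seq I) (S : set T) (H : I -> set T) c :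
  (\big[setI/S]_(i <- s) H i) c <-> S c /\ forall i, i \in s -> H i c.
Proof.
elim: s => [|i s IH]; first by rewrite big_nil; split=> [|[]].
rewrite big_cons; split=> [[Hi /IH[Sc Hs]]|[Sc Hs]].
  by split=> // j; rewrite inE => /predU1P[->//|/Hs].
split; first by apply: Hs; rewrite mem_head.
by apply/IH; split=> // j js; apply: Hs; rewrite inE js orbT.
Qed.

Lemma mem_bigsetU (T : Type) (I : eqType) (s : seq I) (H : I -> set T) c :
  (\big[setU/set0]_(i <- s) H i) c <-> exists2 i, i \in s & H i c.
Proof.
elim: s => [|i s IH]; first by rewrite big_nil; split=> [//|[]].
rewrite big_cons; split=> [[Hi|/IH[j js Hj]]|[j]].
- by exists i; rewrite ?mem_head.
- by exists j; rewrite // inE js orbT.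
by rewrite inE => /predU1P[->|js] Hj; [left|right; apply/IH; exists j].
Qed.

Section CharClass.
Variables (R : realType) (G : groupType).
Implicit Types chi psi : real_hom R G.

Lemma char_class_eq chi psi : char_class chi = char_class psi ->
  exists2 k, 0 < k & forall x, hom_val psi x = k * hom_val chi x.
Proof.
move=> cE; have : char_class psi psi by exists 1 => // x; rewrite mul1r.
by rewrite -cE.
Qed.

End CharClass.

Section Polyhedron.
Variables (V : finType) (e : rel V) (N : groupType) (emb : N -> raag e) (R : realType).
Hypothesis embM : {morph emb : x y / (x * y)%g}.
Hypothesis emb_inj : injective emb.
Hypothesis emb_height : forall p, height (emb p) = 0.
Hypothesis emb_onto : forall g, height g = 0 -> exists p, emb p = g.
Hypothesis e_sym : symmetric e.
Hypothesis conn : forall x y, connect e x y.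

(** Without vertices there is no base point, and the group is trivial. *)
Lemma polyhedron_empty : (V -> False) ->
  rational_polyhedron (char_sphere R N `\` Sigma1 R N).
Proof.
move=> V0; have N1 (p : N) : p = 1%g.
  apply: emb_inj; rewrite (morph_one embM).
  by elim/raag_ind: (emb p) => // g [x]; case: (V0 x).
exists 0%N, (fun=> 1%g); split.
  move=> x; exists [ffun=> 0]; split.
    by exists 1%N => //; rewrite [X in derived_subgroup X]N1; apply: generated1.
  by move=> a _; apply/ffunP => -[].
exists [::]; split=> //; rewrite big_nil -subset0 => c [[chi [p]]].
by rewrite (N1 p) hom_val1.
Qed.

Section Basepoint.
Variable v0 : V.
Local Notation alpha := (char_weight emb_onto v0).
Local Notation basis := (@basis_elt V e N emb emb_onto v0).
Implicit Type chi : real_hom R N.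

Definition flat (W : {set V}) chi : Prop :=
  forall x y, x \in W -> y \in W -> alpha chi x = alpha chi y.

Lemma char_weight_scale chi psi : char_class chi = char_class psi ->
  exists2 k, 0 < k & forall x, alpha psi x = k * alpha chi x.
Proof. by move=> /char_class_eq[k k0 kE]; exists k => // x; apply: kE. Qed.

Lemma flat_class W chi psi : char_class chi = char_class psi -> flat W chi -> flat W psi.
Proof.
move=> /char_weight_scale[k _ kE] fl x y xW yW.
by rewrite !kE (fl x y).
Qed.

(** The criterion that describes the complement of Sigma^1. Being flat on W does
    not depend on the character that represents the class, by flat_class. *)
Lemma not_sigma1P c : (char_sphere R N `\` Sigma1 R N) c <->
  char_sphere R N c /\
  exists W : {set V}, [/\ separating e W, exists x, x \in W &
    forall chi, char_class chi = c -> flat W chi].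
Proof.
split=> [[Sc nc]|[Sc [W [sW W0 fl]]]].
  split=> //; case: Sc nc => chi chic <- nc.
  apply: contrapT => nW; apply: nc; exists chi => //; split=> //.
  apply: (cayley_connected embM emb_inj emb_height emb_onto
    (hom_val_weight embM emb_inj emb_height emb_onto v0 conn chi) chic
    (char_weight0 embM emb_inj emb_onto v0 chi)).
  move=> W sW; apply: contrapT => nxy; apply: nW; exists W; split=> //.
    exact: connect_nonseparating sW.
  move=> psi psiE; apply: (flat_class (esym psiE)) => x y xW yW.
  by apply/eqP; apply: contraT => xy; case: nxy; exists x, y.
split=> // -[chi [chic [X _ XC]] cE].
exact: (separating_disconnected embM emb_height emb_onto
  (hom_val_weight embM emb_inj emb_height emb_onto v0 conn chi) chic e_sym sW W0 (fl _ cE) XC).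
Qed.

(** The linear form alpha x - alpha y in the coordinates of the basis. The
    coordinate of v0 is absent, in accordance with alpha v0 = 0. *)
Definition diff_vector (x y : V) : 'rV[rat]_#|nonbase v0| :=
  \row_i ((x == basis_vertex i)%:R - (y == basis_vertex i)%:R).

Lemma diff_vectorE chi x y :
  \sum_i ratr (diff_vector x y 0 i) * hom_val chi (basis i) = alpha chi x - alpha chi y.
Proof.
have S z : \sum_i (z == basis_vertex i)%:R * hom_val chi (basis i) = alpha chi z.
  have [->|/basis_vertexP[j ->]] := eqVneq z v0.
    rewrite (char_weight0 embM emb_inj) big1// => i _.
    by rewrite eq_sym (negPf (basis_vertex_neq i)) mul0r.
  rewrite (bigD1 j)//= eqxx mul1r big1 ?addr0// => i ij.
  by rewrite (inj_eq (@basis_vertex_inj _ _)) eq_sym (negPf ij) mul0r.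
rewrite -!S -sumrB; apply: eq_bigr => i _.
by rewrite mxE rmorphB /= !ratr_nat mulrBl.
Qed.

Lemma diff_vector_neq0 x y : x != y -> diff_vector x y != 0.
Proof.
move=> xy; apply: contra_neq xy => /rowP D.
have [xv|/basis_vertexP[j xE]] := eqVneq x v0.
  have [->//|/basis_vertexP[j yE]] := eqVneq y v0.
  move: (D j); rewrite !mxE xv yE eqxx eq_sym (negPf (basis_vertex_neq j)) sub0r.
  by move/eqP; rewrite oppr_eq0 oner_eq0.
move: (D j); rewrite !mxE xE eqxx; case: eqVneq => [->//|_ /eqP].
by rewrite subr0 oner_eq0.
Qed.

Lemma mem_hemisphere chi x y : is_character chi ->
  rational_hemisphere basis (diff_vector x y) (char_class chi) <->
  alpha chi y <= alpha chi x.
Proof.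
move=> chic; split=> [[psi [_]]|yx].
  rewrite diff_vectorE subr_ge0 => yx /esym/char_weight_scale[k k0 kE].
  by rewrite -(ler_pM2l k0); move: yx; rewrite !kE.
by exists chi => //; split; rewrite // diff_vectorE subr_ge0.
Qed.

(** The equality alpha x = alpha y is the intersection of the hemispheres of
    diff_vector x y and diff_vector y x; taking all ordered pairs of distinct
    vertices of W gives both, and only nonzero vectors. For a cut vertex the
    list of hemispheres is empty, and the whole sphere is obtained. *)
Lemma polyhedron_basepoint : rational_polyhedron (char_sphere R N `\` Sigma1 R N).
Proof.
exists #|nonbase v0|, basis; split; first exact: basis_elt_basis.
pose hemis (W : {set V}) :=
  [seq diff_vector u.1 u.2 | u <- enum {: V * V} & [&& u.1 \in W, u.2 \in W & u.1 != u.2]].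
have hemisP (W : {set V}) v : v \in hemis W <->
    exists x y, [/\ x \in W, y \in W, x != y & v = diff_vector x y].
  split=> [/mapP[[x y]]|[x [y [xW yW xy ->]]]].
    by rewrite mem_filter => /andP[/and3P[/= xW yW xy] _] ->; exists x, y.
  by apply/mapP; exists (x, y) => //; rewrite mem_filter xW yW xy mem_enum.
exists [seq hemis W | W <- enum {: {set V}} & `[< separating e W /\ exists x, x \in W >]].
split.
  by move=> I v /mapP[W _ ->] /hemisP[x [y [_ _ xy ->]]]; apply: diff_vector_neq0.
apply/seteqP; split=> c.
  move/not_sigma1P => [Sc [W [sW W0 fl]]]; apply/mem_bigsetU; exists (hemis W).
    by apply: map_f; rewrite mem_filter mem_enum andbT; apply/asboolP.
  apply/mem_bigsetI; split=> // v /hemisP[x [y [xW yW _ ->]]].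
  case: Sc fl => chi chic <- /(_ chi erefl) fl.
  by apply/mem_hemisphere => //; rewrite (fl x y).
move/mem_bigsetU => [I /mapP[W]]; rewrite mem_filter => /andP[/asboolP[sW W0] _] ->.
move/mem_bigsetI => [Sc H]; apply/not_sigma1P; split=> //; exists W; split=> //.
case: Sc H => chi chic <- H psi psiE; apply: (flat_class (esym psiE)) => x y xW yW.
have [->//|xy] := eqVneq x y; apply/le_anti/andP; split.
  by apply/mem_hemisphere => //; apply: H; apply/hemisP; exists y, x; rewrite eq_sym.
by apply/mem_hemisphere => //; apply: H; apply/hemisP; exists x, y.
Qed.

End Basepoint.

Theorem height_kernel_polyhedron :
  rational_polyhedron (char_sphere R N `\` Sigma1 R N).
Proof.
have [[v0]|V0] := pselect (inhabited V); first exact: polyhedron_basepoint v0.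
by apply: polyhedron_empty => v; apply: V0.
Qed.

End Polyhedron.

(** * Products of free groups as Artin groups of joins *)

Lemma prodgM_disjoint (G : groupType) (I : eqType) (s : seq I) (E F : I -> G) :
  uniq s -> (forall i j, i != j -> commute (E i) (F j)) ->
  (\prod_(i <- s) (E i * F i) = \prod_(i <- s) E i * \prod_(i <- s) F i)%g.
Proof.
move=> us EF; elim: s us => [_|i s IH /= /andP[i_s us]]; first by rewrite !big_nil mulg1.
rewrite !big_cons IH// -!mulgA; congr (_ * _)%g; rewrite !mulgA; congr (_ * _)%g.
rewrite big_seq; apply: commute_prod => j js; apply: commute_sym; apply: EF.
by apply: contraNneq i_s => <-.
Qed.

Section Join.
Variables (R : realType) (m : nat).
Local Notation F2 := (free_group bool).
Local Notation J := ('I_m * bool)%type.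

Definition join_edge : rel J := fun p q => p.1 != q.1.

Lemma join_edge_sym : symmetric join_edge.
Proof. by move=> p q; rewrite /join_edge eq_sym. Qed.

Lemma join_connect : (2 <= m)%N -> forall p q : J, connect join_edge p q.
Proof.
move=> m2 p q; have [pq|pq] := eqVneq p.1 q.1; last exact: connect1.
have [k kp] : exists k : 'I_m, k != p.1.
  have [p0|p0] := eqVneq (val p.1) 0%N.
    by exists (Ordinal m2); rewrite -val_eqE p0.
  by exists (Ordinal (ltnW m2)); rewrite -val_eqE eq_sym.
apply: (connect_trans (y := (k, true))); apply: connect1; rewrite /join_edge /= -?pq //.
by rewrite eq_sym.
Qed.

Local Notation A := (raag join_edge).
Local Notation gen := (pgen (commutation join_edge)).

Definition factor_gen (p : J) : {ffun 'I_m -> F2} :=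
  [ffun j => if j == p.1 then pgen (@no_relation bool) p.2 else 1%g].

Fact factor_gen_rels (l r : word J) :
  commutation join_edge l r -> weval factor_gen l = weval factor_gen r.
Proof.
case=> p q pq; rewrite /weval !big_cons !big_nil /= !mulg1.
apply/ffunP => j; rewrite !ffunE; case: eqVneq => [jp|_]; last by rewrite mul1g mulg1.
by rewrite jp (negPf pq) mul1g mulg1.
Qed.

Definition to_product : {multiplicative A -> {ffun 'I_m -> F2}} :=
  pres_lift factor_gen_rels.

Definition from_factor (i : 'I_m) : {multiplicative F2 -> A} :=
  @pres_lift _ _ A (fun b => gen (i, b)) (fun _ _ => False_ind _).

Lemma from_factor_gen i b : from_factor i (pgen _ b) = gen (i, b).
Proof. exact: (@pres_lift_pgen _ _ A (fun b => gen (i, b)) (fun _ _ => False_ind _) b). Qed.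

Lemma to_product_gen p : to_product (gen p) = factor_gen p.
Proof. exact: (pres_lift_pgen factor_gen_rels p). Qed.

Lemma from_factor_commute i j a b : i != j -> commute (from_factor i a) (from_factor j b).
Proof.
move=> ij; apply: presented_commute => [|y]; first exact: gmulfM.
apply: commute_sym; apply: presented_commute => [|x]; first exact: gmulfM.
rewrite !from_factor_gen; apply: commute_sym; exact: (@letter_commute _ join_edge (i, x) (j, y) true true).
Qed.

Definition from_product (u : {ffun 'I_m -> F2}) : A := (\prod_(i < m) from_factor i (u i))%g.

(** The images of the different factors commute, since any two of their generators are
    adjacent vertices. *)
Lemma from_productM : {morph from_product : u v / (u * v)%g}.
Proof.
move=> u v; rewrite /from_product -prodgM_disjoint ?index_enum_uniq//.
  by apply: eq_bigr => i _; rewrite ffunE gmulfM.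
by move=> i j ij; apply: from_factor_commute.
Qed.

Lemma from_productK : cancel from_product to_product.
Proof.
move=> u; apply/ffunP => j.
have tM : {morph (fun g => to_product g j) : g h / (g * h)%g}.
  by move=> g h; rewrite gmulfM ffunE.
rewrite /from_product (big_morph (fun g => to_product g j) tM (morph_one tM)).
have E i : to_product (from_factor i (u i)) j = (if i == j then u j else 1)%g.
  suff -> : to_product (from_factor i (u i)) j = (if i == j then u i else 1)%g.
    by case: eqVneq => [->|].
  apply: (presented_morph_eq (f := fun a => to_product (from_factor i a) j)
    (g := fun a => if i == j then a else 1%g)) => [a b|a b|b].
  - by rewrite gmulfM tM.
  - by case: (i == j); rewrite ?mulg1.
  - by rewrite from_factor_gen to_product_gen ffunE eq_sym.
under eq_bigr => i _ do rewrite E.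
by rewrite -big_mkcond big_pred1_eq.
Qed.

Lemma to_productK : cancel to_product from_product.
Proof.
apply: (presented_morph_eq (f := from_product \o to_product) (g := id)) => [g h|//|p /=].
  by rewrite /= gmulfM from_productM.
rewrite to_product_gen /from_product.
have E i : from_factor i (factor_gen p i) = (if i == p.1 then gen p else 1)%g.
  rewrite ffunE; case: eqVneq => [->|_]; first by rewrite from_factor_gen -surjective_pairing.
  by apply: (@morph_one _ _ (from_factor i)) => a b; rewrite gmulfM.
under eq_bigr => i _ do rewrite E.
by rewrite -big_mkcond big_pred1_eq.
Qed.

Lemma bs_height_to_product g : bs_height R (to_product g) = (height g)%:~R.
Proof.
apply: (presented_morph_eq (H := GRing.to_multiplicative R)
  (f := fun g => bs_height R (to_product g)) (g := fun g => (height g)%:~R)) => [a b|a b|p].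
- by rewrite gmulfM bs_heightM.
- by rewrite /height weightM intrD.
rewrite to_product_gen /height (@weight_letter _ join_edge _ _ (p, true)) /signed /=.
have E i : free2_height R (factor_gen p i) =
    (if i == p.1 then 1%R : GRing.to_multiplicative R else 1%g).
  rewrite ffunE; case: eqVneq => _; first exact: free2_height_gen.
  by apply: (@morph_one _ _ (free2_height R)) => a b; rewrite gmulfM.
rewrite /bs_height; under eq_bigr => i _ do rewrite E.
by rewrite -big_mkcond big_pred1_eq.
Qed.

End Join.

Section Conclusion.
Variable R : realType.

Lemma bestvina_brady_polyhedron (V : finType) (e : rel V) :
  symmetric e -> (forall x y, connect e x y) ->
  rational_polyhedron (char_sphere R (bestvina_brady e) `\` Sigma1 R (bestvina_brady e)).
Proof.
move=> es conn.
apply: (@height_kernel_polyhedron V e _ (@kernel_val _ _ (raag_height e))) => //.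
- exact: val_inj.
- by move=> [g /= /eqP gh]; rewrite -raag_heightE gh.
move=> g g0; have gk : ker_pred (raag_height e) g by apply/eqP; rewrite raag_heightE.
by exists (Kernel gk).
Qed.

Lemma bieri_stallings_polyhedron (m : nat) : (2 <= m)%N ->
  rational_polyhedron (char_sphere R (bieri_stallings R m) `\` Sigma1 R (bieri_stallings R m)).
Proof.
move=> m2.
apply: (@height_kernel_polyhedron _ (@join_edge m) _ (fun p => from_product (kernel_val p))).
- by move=> p q; rewrite -from_productM.
- by move=> p q /(can_inj (@from_productK m)) /val_inj.
- move=> [u /= /eqP u0]; apply/eqP; rewrite -(intr_eq0 R) -bs_height_to_product from_productK.
  exact/eqP.
- move=> g g0; have gk : ker_pred (@bs_height R m) (to_product m g).
    by apply/eqP; apply: etrans (bs_height_to_product R g) _; rewrite g0.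
  by exists (Kernel gk); apply: to_productK.
- exact: join_edge_sym.
- exact: join_connect.
Qed.

End Conclusion.

Theorem corollary1p4 (R : realType) :
  (forall (V : finType) (e : rel V),
     symmetric e -> irreflexive e -> (forall x y, connect e x y) ->
     rational_polyhedron
       (char_sphere R (bestvina_brady e) `\` Sigma1 R (bestvina_brady e)))
  /\
  (forall m : nat, (2 <= m)%N ->
     rational_polyhedron
       (char_sphere R (bieri_stallings R m) `\` Sigma1 R (bieri_stallings R m))).
Proof.
split=> [V e e_sym _ conn|m m2]; first exact: bestvina_brady_polyhedron.
exact: bieri_stallings_polyhedron.
Qed.
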